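(* Let $F = J_q(f)$ for a fixed integer $q \geq 2$ and a symmetric kernel $f \in \ell^2_0(\mathbb{N})^{\circ q}$. Assume that $\|(f\star_r^r f)\mathbf{1}_{\Delta_{2(q-r)}}\|_{\ell^2(\mathbb{N})^{\otimes 2(q-r)}} < 1$ for all $r=1, \dots, q-1$. Furthermore, let $N$ be a standard Gaussian random variable. Then \begin{align*} d_K(F, N) &\leq C_1\max\Big\{\big|1-q!\|f\|_{\ell^2(\mathbb{N})^{\otimes q}}^2\big|,\ \max_{r=1,\ldots,q-1}\|(f\star_r^r f)\mathbf{1}_{\Delta_{2(q-r)}}\|_{\ell^2(\mathbb{N})^{\otimes 2(q-r)}},\ \max_{r=1,\ldots,q}\|f\star_r^{r-1} f\|_{\ell^2(\mathbb{N})^{\otimes(2(q-r)+1)}}\Big\}\\ &\leq C_2\max\Big\{\big|1-q!\|f\|_{\ell^2(\mathbb{N})^{\otimes q}}^2\big|,\ \max_{r=1,\ldots,q-1}\|f\star_r^r f\|_{\ell^2(\mathbb{N})^{\otimes 2(q-r)}}\Big\} \end{align*} with universal constants $0<C_1,C_2<\infty$ only depending on $q$.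
   Context: $(X_n)_{n\in\mathbb{N}}$ is a Rademacher sequence: i.i.d. with $P(X_n=\pm1)=\frac12$. $\Delta_n=\{(i_1,\dots,i_n)\in\mathbb{N}^n: i_k\ne i_l\text{ for }k\neq l\}$. $\ell^2(\mathbb{N})^{\otimes n}$ is the space of square-summable functions on $\mathbb{N}^n$ with its usual norm, and $\ell_0^2(\mathbb{N})^{\circ n}$ is its subset of symmetric functions vanishing outside $\Delta_n$. Discrete multiple stochastic integral: $J_q(f)=q!\sum_{1\le i_1<\dots<i_q<\infty}f(i_1,\dots,i_q)X_{i_1}\cdots X_{i_q}$ for $f\in\ell_0^2(\mathbb{N})^{\circ q}$. Contractions: for $f\in\ell_0^2(\mathbb{N})^{\circ n}$, $g\in\ell_0^2(\mathbb{N})^{\circ m}$, $0\le r\le n\wedge m$, $0\le l\le r$, the function $f\star_r^lg$ on $\mathbb{N}^{n+m-r-l}$ is $$f\star_r^lg(i_1,\dots,i_{n-r},j_1,\dots,j_{r-l},k_1,\dots,k_{m-r})=\sum_{(a_1,\dots,a_l)\in\Delta_l}f(i_1,\dots,i_{n-r},j_1,\dots,j_{r-l},a_1,\dots,a_l)\,g(k_1,\dots,k_{m-r},j_1,\dots,j_{r-l},a_1,\dots,a_l)$$ (no summation if $l=0$). The Kolmogorov distance is $d_K(F,N)=\sup_{x\in\mathbb{R}}|P(F\le x)-P(N\le x)|$. *)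

(* Defs.v *)
From HB Require Import structures.
From mathcomp Require Import all_boot all_order all_algebra.
From mathcomp Require Import perm finmap.
From mathcomp Require Import all_classical all_reals all_analysis.

Set Implicit Arguments.
Unset Strict Implicit.
Unset Printing Implicit Defensive.

Import Order.TTheory GRing.Theory Num.Theory.
Import numFieldNormedType.Exports.

Local Open Scope classical_set_scope.
Local Open Scope ring_scope.

(* Mutual independence: the product rule over all finite subfamilies. *)
Definition independent_seq d (T : measurableType d) (R : realType)
    (P : probability T R) (X : nat -> {RV P >-> R}) : Prop :=
  forall (J : {fset nat}) (A : nat -> set R),
    (forall i, measurable (A i)) ->
    P (\bigcap_(i in [set` J]) (X i @^-1` A i))
      = (\prod_(i <- J) P (X i @^-1` A i))%E.

Definition rademacher_seq d (T : measurableType d) (R : realType)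
    (P : probability T R) (X : nat -> {RV P >-> R}) : Prop :=
  independent_seq X /\
  forall n, P (X n @^-1` [set 1]) = (2^-1)%:E /\
            P (X n @^-1` [set -1]) = (2^-1)%:E.

Definition std_gaussian d (T : measurableType d) (R : realType)
    (P : probability T R) (N : {RV P >-> R}) : Prop :=
  forall A : set R, measurable A -> distribution P N A = normal_prob 0 1 A.

Definition kolmogorov_dist d1 (T1 : measurableType d1) d2
    (T2 : measurableType d2) (R : realType) (P1 : probability T1 R)
    (P2 : probability T2 R) (F : {RV P1 >-> R}) (N : {RV P2 >-> R}) : \bar R :=
  ereal_sup [set `|cdf F x - cdf N x|%E | x in [set: R]].

Definition Delta (n : nat) : set (n.-tuple nat) := [set t | uniq t].
Arguments Delta n : clear implicits.

Definition restrict_Delta (R : realType) (n : nat) (f : n.-tuple nat -> R) :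
    n.-tuple nat -> R :=
  fun t => f t * \1_(Delta n) t.

(* The norm is +oo when f is not square-summable. *)
Definition l2norm (R : realType) (n : nat) (f : n.-tuple nat -> R) : \bar R :=
  sqrte (\esum_(t in [set: n.-tuple nat]) (f t ^+ 2)%:E).

Definition l2_0_sym (R : realType) (n : nat) (f : n.-tuple nat -> R) : Prop :=
  [/\ (l2norm f < +oo)%E,
      forall (s : 'S_n) (t : n.-tuple nat),
        f [tuple tnth t (s k) | k < n] = f t
    & forall t : n.-tuple nat, ~ Delta n t -> f t = 0].

(* The sum of an absolutely summable family of real numbers. *)
Definition rsum (R : realType) (I : choiceType) (D : set I) (u : I -> R) : R :=
  fine (\esum_(i in D) (Num.max (u i) 0)%:E)
  - fine (\esum_(i in D) (Num.max (- u i) 0)%:E).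

(* f read on a sequence of length n; this avoids casts between the arities
   n and (n - r) + (r - l) + l, and the padding value 0 is then never used. *)
Definition seq_eval (R : realType) (n : nat) (f : n.-tuple nat -> R)
    (s : seq nat) : R :=
  f [tuple nth 0%N s k | k < n].

Lemma seq_eval_tuple (R : realType) (n : nat) (f : n.-tuple nat -> R)
    (t : n.-tuple nat) : seq_eval f t = f t.
Proof.
by congr f; apply: eq_from_tnth => k; rewrite tnth_mktuple (tnth_nth 0%N).
Qed.

(* Meaningful for l <= r <= minn n m: the argument t then splits as
   i ++ j ++ k with blocks of sizes n - r, r - l and m - r. *)
Definition star_contr (R : realType) (n m : nat) (f : n.-tuple nat -> R)
    (g : m.-tuple nat -> R) (r l : nat) (t : (n + m - r - l).-tuple nat) : R :=
  let i := take (n - r) t in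
  let j := take (r - l) (drop (n - r) t) in
  let k := drop (n - l) t in
  rsum (Delta l) (fun a : l.-tuple nat =>
    seq_eval f (i ++ j ++ a) * seq_eval g (k ++ j ++ a)).

Arguments star_contr {R n m} f g r l t.

Definition mult_integral_trunc d (T : measurableType d) (R : realType)
    (P : probability T R) (X : nat -> {RV P >-> R}) (q : nat)
    (f : q.-tuple nat -> R) (n : nat) (w : T) : R :=
  q`!%:R * \sum_(t : q.-tuple 'I_n | sorted ltn (map val t))
             f (map_tuple val t) * \prod_(k < q) X (tnth t k) w.

(* F = J_q(f): the infinite sum defining J_q(f) converges in L^2(P), so J_q(f)
   is the random variable, unique up to almost sure equality, that is the limit
   in L^2(P) of the sums over i_1 < ... < i_q < n. *)
Definition is_mult_integral d (T : measurableType d) (R : realType)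
    (P : probability T R) (X : nat -> {RV P >-> R}) (q : nat)
    (f : q.-tuple nat -> R) (F : {RV P >-> R}) : Prop :=
  ('E_P[fun w => ((F w - mult_integral_trunc X f n w) ^+ 2)%R]
     @[n --> \oo] --> 0)%E.

(* Main.v *)
(* Truncating the kernel to indices below n turns F into a homogeneous Walsh
   polynomial of degree q on the cube {-1,1}^n.  There, with D_i the discrete
   derivative, Stein's method rests on E[F g(F)] = q^-1 sum_i E[D_i F D_i g(F)].
   For the solution g of Stein's equation at z, both t g(t) and
   psi(t) = t g(t) - 1(t <= z) are nondecreasing, so that
     |D_i F D_i g(F) - (D_i F)^2 g'(F)| <= 2 |D_i F| D_i F D_i psi(F),
   and moving D_i from the bounded psi(F) back by duality gives
     d_K <= 2 E|1 - q^-1 sum_i (D_i F)^2| + 4 q^-1 E|sum_i X_i |D_i F| D_i F|.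
   The Walsh coefficients of sum_i (D_i F)^2 are sums of restricted contractions
   f *_r^r f over the splittings of the index set, and the second moment of the
   last sum is, by hypercontractivity, of the order of sum_i (E (D_i F)^2)^2,
   which is up to a constant the squared norm of f *_q^(q-1) f.  All the estimates survive
   n -> oo, since truncation changes the contractions by at most the l^2-mass
   of the tail of f.
   For the second inequality, f *_r^(r-1) f with r >= 2 is the restriction of
   f *_(r-1)^(r-1) f to a diagonal, and f *_1^0 f has the norm of
   f *_q^(q-1) f. *)

Require Import Defs.
From HB Require Import structures.
From mathcomp Require Import all_boot all_order all_algebra.
From mathcomp Require Import perm finmap.
From mathcomp Require Import all_classical all_reals all_analysis.
From mathcomp Require Import measurable_realfun ring lra zify.

Set Implicit Arguments.
Unset Strict Implicit.
Unset Printing Implicit Defensive.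

Import Order.TTheory GRing.Theory Num.Theory.
Import numFieldNormedType.Exports.

Local Open Scope ring_scope.

(** * Fourier-Walsh calculus on the discrete cube *)

(** The derivative of the Stein solution jumps at z, so no derivative enters the cube: [g] is seen
    only through boundedness and monotonicity of t g(t) and a two-sided bound on its increments. The
    cube part is thereby finite algebra over any real field. Kernels that are symmetric and vanish
    on diagonals become functions of finite sets; products of characters are then indexed by
    symmetric differences, whose two halves are disjoint, and this is why contractions restricted to
    [Delta] suffice for the variance of sum_i (D_i F)^2. Contractions involve cancellation, so
    truncation need not decrease them and a tail term remains; influences are sums of squares and
    need none. The passage from the truncated integrals to F is made on distribution functions:
    Chebyshev's inequality yields a small exceptional event, and the remaining shift of the argument
    is absorbed by the Lipschitz Gaussian distribution function. The second inequality holds between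
    the two maxima themselves, so a single constant serves for both. *)

Lemma sum_CauchySchwarz (R : realFieldType) (I : Type) (r : seq I) (Q : pred I)
    (x y : I -> R) :
  (\sum_(i <- r | Q i) x i * y i) ^+ 2 <=
  (\sum_(i <- r | Q i) x i ^+ 2) * \sum_(i <- r | Q i) y i ^+ 2.
Proof.
set m := \sum_(i <- r | Q i) _; set a := \sum_(i <- r | Q i) _; set b := \sum_(i <- r | Q i) _.
have K (s t : R) : 0 <= s ^+ 2 * a - 2 * s * t * m + t ^+ 2 * b.
  rewrite !mulr_sumr -sumrB -big_split; apply: sumr_ge0 => i _ /=.
  have -> : s ^+ 2 * x i ^+ 2 - 2 * s * t * (x i * y i) + t ^+ 2 * y i ^+ 2
          = (s * x i - t * y i) ^+ 2 by ring.
  exact: sqr_ge0.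
have a0 : 0 <= a by apply: sumr_ge0 => i _; exact: sqr_ge0.
have b0 : 0 <= b by apply: sumr_ge0 => i _; exact: sqr_ge0.
have [b_eq0|b_neq0] := eqVneq b 0.
  (* Here the form is affine in t: at s = m, t = a + 1 it equals -(a + 2) m^2, so m = 0. *)
  have := K 1 (m * (a + 1)); have := K m (a + 1); rewrite b_eq0; nra.
have b_gt0 : 0 < b by rewrite lt_neqAle eq_sym b_neq0.
have := K b m.
have -> : b ^+ 2 * a - 2 * b * m * m + m ^+ 2 * b = b * (a * b - m ^+ 2) by ring.
by rewrite pmulr_rge0 // subr_ge0.
Qed.

Section Cube.
Variables (R : realFieldType) (n : nat).
Notation cube := {ffun 'I_n -> bool}.
Implicit Types (i j : 'I_n) (w : cube) (G H u v : cube -> R) (S U V : {set 'I_n})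
  (c : {set 'I_n} -> R).

Definition sgn i w : R := (-1) ^+ w i.
Definition flip i w : cube := [ffun j => (j == i) (+) w j].
Definition Ex G : R := (2 ^+ n)^-1 * \sum_w G w.
(* (G at w_i = +1) - (G at w_i = -1), halved; hence independent of w_i. *)
Definition dif i G w : R := sgn i w * (G w - G (flip i w)) / 2.
Definition chi S w : R := \prod_(i in S) sgn i w.
Definition walsh c w : R := \sum_S c S * chi S w.

Lemma flipK i : involutive (flip i).
Proof. by move=> w; apply/ffunP => j; rewrite !ffunE addKb. Qed.

Lemma flipC i j w : flip i (flip j w) = flip j (flip i w).
Proof. by apply/ffunP => k; rewrite !ffunE addbCA. Qed.

Lemma sgn_flip i w : sgn i (flip i w) = - sgn i w.
Proof. by rewrite /sgn ffunE eqxx; case: (w i); rewrite ?expr0 ?expr1 ?opprK. Qed.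

Lemma sgn_flip_neq i j w : i != j -> sgn i (flip j w) = sgn i w.
Proof. by rewrite /sgn ffunE => /negbTE ->. Qed.

Lemma sgn_sqr i w : sgn i w ^+ 2 = 1.
Proof. by rewrite /sgn -exprM mulnC exprM sqrrN expr1n expr1n. Qed.

Lemma eq_Ex G H : G =1 H -> Ex G = Ex H.
Proof. by move=> GH; rewrite /Ex (eq_bigr _ (fun w _ => GH w)). Qed.

Lemma Ex_flip i G : Ex (fun w => G (flip i w)) = Ex G.
Proof.
rewrite /Ex; congr (_ * _); rewrite [RHS](reindex_onto (flip i) (flip i)) /=.
  by apply: eq_bigl => w; rewrite flipK eqxx.
by move=> w _; rewrite flipK.
Qed.

Lemma ExD G H : Ex (fun w => G w + H w) = Ex G + Ex H.
Proof. by rewrite /Ex big_split mulrDr. Qed.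

Lemma ExZ (a : R) G : Ex (fun w => a * G w) = a * Ex G.
Proof. by rewrite /Ex -mulr_sumr mulrCA. Qed.

Lemma ExN G : Ex (fun w => - G w) = - Ex G.
Proof. by rewrite -mulN1r -ExZ; apply: eq_Ex => w; rewrite mulN1r. Qed.

Lemma ExB G H : Ex (fun w => G w - H w) = Ex G - Ex H.
Proof. by rewrite ExD ExN. Qed.

Lemma Ex_sum (I : Type) (r : seq I) (Q : pred I) (G : I -> cube -> R) :
  Ex (fun w => \sum_(k <- r | Q k) G k w) = \sum_(k <- r | Q k) Ex (G k).
Proof. by rewrite /Ex exchange_big mulr_sumr. Qed.

Lemma Ex_ge0 G : (forall w, 0 <= G w) -> 0 <= Ex G.
Proof.
by move=> G0; rewrite mulr_ge0 ?invr_ge0 ?exprn_ge0 // sumr_ge0 => // w _.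
Qed.

Lemma le_Ex G H : (forall w, G w <= H w) -> Ex G <= Ex H.
Proof. by move=> GH; rewrite -subr_ge0 -ExB Ex_ge0 // => w; rewrite subr_ge0. Qed.

Lemma Ex_cst (a : R) : Ex (fun=> a) = a.
Proof.
have -> : Ex (fun=> a) = (2 ^+ n)^-1 * (a *+ (2 ^ n)).
  by rewrite /Ex sumr_const card_ffun card_bool card_ord.
by rewrite -[a *+ _]mulr_natl natrX mulKf // expf_neq0 // pnatr_eq0.
Qed.

Lemma normr_Ex G : `|Ex G| <= Ex (fun w => `|G w|).
Proof.
rewrite /Ex normrM ger0_norm ?invr_ge0 ?exprn_ge0 //.
by rewrite ler_wpM2l ?invr_ge0 ?exprn_ge0 // ler_norm_sum.
Qed.

Lemma Ex_CauchySchwarz G H :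
  Ex (fun w => G w * H w) ^+ 2 <= Ex (fun w => G w ^+ 2) * Ex (fun w => H w ^+ 2).
Proof.
rewrite /Ex [leRHS]mulrACA -expr2 exprMn ler_wpM2l ?sqr_ge0 //.
exact: sum_CauchySchwarz.
Qed.

Lemma dif_flip i G w : dif i G (flip i w) = dif i G w.
Proof. by rewrite /dif flipK sgn_flip; ring. Qed.

Lemma dif_flip_neq i j G w : i != j ->
  dif i G (flip j w) = dif i (fun w => G (flip j w)) w.
Proof. by move=> ij; rewrite /dif sgn_flip_neq // flipC. Qed.

(** Integration by parts: [flip i] preserves the mean and reverses the sign of w_i, so averaging
    over w and its flip leaves only the part of G that is odd in w_i, as [u] does not see that
    coordinate. *)
Lemma Ex_dual i u G : (forall w, u (flip i w) = u w) ->
  Ex (fun w => sgn i w * u w * G w) = Ex (fun w => u w * dif i G w).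
Proof.
move=> ui; set a := LHS.
have E : Ex (fun w => u w * dif i G w) =
    2^-1 * (a - Ex (fun w => sgn i w * u w * G (flip i w))).
  by rewrite -ExB -ExZ; apply: eq_Ex => w; rewrite /dif; ring.
rewrite E -(Ex_flip i) (_ : Ex _ = - a); first by field.
by rewrite -ExN; apply: eq_Ex => w; rewrite flipK sgn_flip ui; ring.
Qed.

Lemma chi_flip S i w : chi S (flip i w) = (if i \in S then -1 else 1) * chi S w.
Proof.
rewrite /chi; case: ifP => iS; last first.
  rewrite mul1r; apply: eq_bigr => j jS; rewrite sgn_flip_neq //.
  by apply: contraTneq jS => ->; rewrite iS.
rewrite (bigD1 i) //= sgn_flip [in RHS](bigD1 i) //= mulN1r mulNr; congr (- (_ * _)).
by apply: eq_bigr => j /andP[_ ji]; rewrite sgn_flip_neq.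
Qed.

Lemma chiU1 S i w : i \notin S -> chi (i |: S) w = sgn i w * chi S w.
Proof. by move=> iS; rewrite /chi big_setU1. Qed.

Lemma walsh_dif i c w :
  dif i (walsh c) w = walsh (fun S => if i \in S then 0 else c (i |: S)) w.
Proof.
rewrite /dif /walsh -sumrB mulr_sumr mulr_suml.
rewrite (bigID (fun S => i \in S)) /= [X in _ + X]big1 ?addr0; last first.
  by move=> S iS; rewrite chi_flip (negbTE iS) mul1r subrr mulr0 mul0r.
rewrite [RHS](bigID (fun S => i \in S)) /= [X in _ = X + _]big1 ?add0r; last first.
  by move=> S iS; rewrite iS mul0r.
rewrite (reindex_onto (fun S => i |: S) (fun S => S :\ i)) /=; last first.
  by move=> S iS; rewrite finset.setD1K.
apply: eq_big => [S|S].
  rewrite finset.setU11 /=; apply/eqP/idP => [<-|]; first by rewrite finset.setD11.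
  exact: finset.setU1K.
rewrite finset.setU11 /= => /eqP iS; have {}iS : i \notin S by rewrite -iS finset.setD11.
rewrite chi_flip finset.setU11 (chiU1 _ iS) (negbTE iS).
have -> (y : R) : sgn i w * (c (i |: S) * y - c (i |: S) * (-1 * y)) / 2 =
  sgn i w * (c (i |: S)) * y by field.
by rewrite mulrCA !mulrA -mulrA -expr2 sgn_sqr; ring.
Qed.

(** The form A + w_i B, with A and B free of w_i, lets the induction for [hypercontractivity] remove
    one coordinate at a time. *)
Lemma walsh_split i c w :
  walsh c w = walsh (fun S => if i \in S then 0 else c S) w + sgn i w * dif i (walsh c) w.
Proof.
rewrite /dif !mulrA -expr2 sgn_sqr mul1r.
rewrite /walsh -sumrB mulr_suml -big_split; apply: eq_bigr => S _ /=.
by rewrite chi_flip; case: ifP => _; field.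
Qed.

Lemma Ex_chi S : Ex (chi S) = (S == finset.set0)%:R.
Proof.
have [->|[i iS]] := finset.set_0Vmem S.
  rewrite eqxx -[RHS]Ex_cst; apply: eq_Ex => w; by rewrite /chi big_set0.
have -> : (S == finset.set0) = false by apply: contraTF iS => /eqP->; rewrite inE.
have : Ex (chi S) = - Ex (chi S).
  rewrite -{1}(Ex_flip i) -ExN; apply: eq_Ex => w.
  by rewrite chi_flip iS mulN1r.
by move=> h; rewrite mulr0n; lra.
Qed.

Definition symd S U := (S :\: U) :|: (U :\: S).

Lemma symd_eq0 S U : (symd S U == finset.set0) = (S == U).
Proof.
by rewrite /symd finset.setU_eq0 !finset.setD_eq0 finset.eqEsubset.
Qed.

Lemma chiM S U w : chi S w * chi U w = chi (symd S U) w.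
Proof.
rewrite /chi [in LHS]big_mkcond [X in _ * X]big_mkcond [RHS]big_mkcond -big_split.
apply: eq_bigr => i _ /=.
rewrite !inE; case: (i \in S); case: (i \in U);
  by rewrite //= ?mulr1 ?mul1r // -expr2 sgn_sqr.
Qed.

Lemma walsh_sqr c w :
  walsh c w ^+ 2 = \sum_S \sum_U c S * c U * chi (symd S U) w.
Proof.
rewrite expr2 /walsh mulr_suml; apply: eq_bigr => S _; rewrite mulr_sumr.
by apply: eq_bigr => U _; rewrite -chiM; ring.
Qed.

Lemma Ex_walsh_sqr c : Ex (fun w => walsh c w ^+ 2) = \sum_S c S ^+ 2.
Proof.
rewrite (eq_Ex (walsh_sqr c)) Ex_sum; apply: eq_bigr => S _.
rewrite Ex_sum (bigD1 S) //= big1 ?addr0 => [|U US].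
  by rewrite ExZ Ex_chi symd_eq0 eqxx mulr1 expr2.
by rewrite ExZ Ex_chi symd_eq0 eq_sym (negbTE US) mulr0.
Qed.

Lemma walsh_flip i c w : (forall S, i \in S -> c S = 0) ->
  walsh c (flip i w) = walsh c w.
Proof.
move=> ci; apply: eq_bigr => S _; rewrite chi_flip; case: ifP => iS; last by rewrite mul1r.
by rewrite ci // !mul0r.
Qed.

Section OneCoordinate.
Variables (i : 'I_n) (u v : cube -> R).
Hypotheses (ui : forall w, u (flip i w) = u w) (vi : forall w, v (flip i w) = v w).

Lemma Ex_affine_sqr :
  Ex (fun w => (u w + sgn i w * v w) ^+ 2) =
  Ex (fun w => u w ^+ 2) + Ex (fun w => v w ^+ 2).
Proof.
apply: (@mulfI _ 2); first by rewrite pnatr_eq0.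
rewrite -[LHS]addr0 mulr_natl mulr2n addr0 -{1}(Ex_flip i) -!ExD -ExZ.
apply: eq_Ex => w; rewrite ui vi sgn_flip.
transitivity (2 * u w ^+ 2 + 2 * (sgn i w ^+ 2 * v w ^+ 2)); first by ring.
by rewrite sgn_sqr; ring.
Qed.

Lemma Ex_affine_pow4 :
  Ex (fun w => (u w + sgn i w * v w) ^+ 4) =
  Ex (fun w => u w ^+ 4) + 6 * Ex (fun w => u w ^+ 2 * v w ^+ 2) +
  Ex (fun w => v w ^+ 4).
Proof.
apply: (@mulfI _ 2); first by rewrite pnatr_eq0.
rewrite -[LHS]addr0 mulr_natl mulr2n addr0 -{1}(Ex_flip i) -ExZ -!ExD -ExZ.
apply: eq_Ex => w; rewrite ui vi sgn_flip.
transitivity (2 * u w ^+ 4 + 12 * (sgn i w ^+ 2 * (u w ^+ 2 * v w ^+ 2)) +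
  2 * (sgn i w ^+ 2 * sgn i w ^+ 2 * v w ^+ 4)); first by ring.
by rewrite !sgn_sqr; ring.
Qed.

End OneCoordinate.

(** Inductive step of Bonami's inequality for A + w_i B: t is 3^d, a and b are the second moments,
    and p, r, s the means of A^4, A^2 B^2, B^4. B has one degree less, hence no factor 3 in its
    bound, and the cross term 6 r <= 18 t^2 a b is exactly the mixed term of 9 t^2 (a + b)^2. This
    fixes the constant 3. *)
Lemma two_point_pow4 (t a b p r s : R) :
  0 <= t -> 0 <= a -> 0 <= b -> 0 <= p -> 0 <= r -> 0 <= s ->
  p <= (3 * t * a) ^+ 2 -> s <= (t * b) ^+ 2 -> r ^+ 2 <= p * s ->
  p + 6 * r + s <= (3 * t * (a + b)) ^+ 2.
Proof.
move=> t0 a0 b0 p0 r0 s0 pa sb rps.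
have : r <= (3 * t * a) * (t * b).
  rewrite -(@ler_pXn2r _ 2) // ?nnegrE ?mulr_ge0 //.
  by rewrite exprMn; apply: le_trans rps _; rewrite ler_pM.
have : 0 <= t * b * (t * b) by rewrite !mulr_ge0.
nra.
Qed.

(** Bonami's inequality between fourth and second moments. The induction removes a coordinate from
    V; the part multiplied by the removed sign also loses one degree. *)
Lemma hypercontractivity d (V : {set 'I_n}) c :
  (forall S, c S != 0 -> S \subset V /\ (#|S| <= d)%N) ->
  Ex (fun w => walsh c w ^+ 4) <= (3 ^+ d * Ex (fun w => walsh c w ^+ 2)) ^+ 2.
Proof.
have cst c' : (forall S, c' S != 0 -> S = finset.set0) -> forall e,
    Ex (fun w => walsh c' w ^+ 4) <= (3 ^+ e * Ex (fun w => walsh c' w ^+ 2)) ^+ 2.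
  move=> c0 e.
  have pc w : walsh c' w = c' finset.set0.
    rewrite /walsh (bigD1 finset.set0) //= big1 ?addr0 ?/chi ?big_set0 ?mulr1 // => S S0.
    have [->|/c0] := eqVneq (c' S) 0; first by rewrite mul0r.
    by move=> SS; rewrite SS eqxx in S0.
  rewrite (eq_Ex (H := fun=> c' finset.set0 ^+ 4)) => [|w]; last by rewrite pc.
  rewrite [X in _ * X](eq_Ex (H := fun=> c' finset.set0 ^+ 2)) => [|w]; last by rewrite pc.
  rewrite !Ex_cst exprMn -exprM -exprM ler_peMl ?exprn_even_ge0 //.
  by rewrite exprn_ege1 // ler1n.
elim: {V}#|V| {-2}V (erefl #|V|) d c => [|m IHm] V Vm d c cV.
  apply: cst => S /cV[SV _]; apply/eqP; rewrite -finset.subset0.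
  by move: Vm SV => /eqP; rewrite cards_eq0 => /eqP ->.
case: d cV => [|d] cV.
  by apply: cst => S /cV[_]; rewrite leqn0 cards_eq0 => /eqP.
have [i iV] : exists i, i \in V by apply/set0Pn; rewrite -card_gt0 Vm.
set cA := fun S : {set 'I_n} => if i \in S then 0 else c S.
set cB := fun S : {set 'I_n} => if i \in S then 0 else c (i |: S).
have VD : #|V :\ i| = m by move: Vm; rewrite (cardsD1 i) iV add1n => -[].
have hA S : cA S != 0 -> S \subset V :\ i /\ (#|S| <= d.+1)%N.
  rewrite /cA; case: ifPn => iS; first by rewrite eqxx.
  by move=> /cV[SV Sd]; rewrite finset.subsetD1 SV.
have hB S : cB S != 0 -> S \subset V :\ i /\ (#|S| <= d)%N.
  rewrite /cB; case: ifPn => iS; first by rewrite eqxx.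
  move=> /cV[SV]; rewrite cardsU1 iS add1n ltnS => ->.
  by rewrite finset.subsetD1 iS (fintype.subset_trans _ SV) // finset.subsetUr.
have HA := IHm _ VD _ _ hA; have HB := IHm _ VD _ _ hB.
have fA w : walsh cA (flip i w) = walsh cA w by apply: walsh_flip => S iS; rewrite /cA iS.
have fB w : walsh cB (flip i w) = walsh cB w by apply: walsh_flip => S iS; rewrite /cB iS.
have E w : walsh c w = walsh cA w + sgn i w * walsh cB w by rewrite (walsh_split i) walsh_dif.
pose G w := walsh cA w + sgn i w * walsh cB w.
rewrite (eq_Ex (H := fun w => G w ^+ 4)) => [|w]; last by rewrite E.
rewrite [X in _ <= (_ * X) ^+ 2](eq_Ex (H := fun w => G w ^+ 2)) => [|w]; last by rewrite E.
rewrite {}/G.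
rewrite Ex_affine_sqr // Ex_affine_pow4 //.
have sq0 c' : 0 <= Ex (fun w => walsh c' w ^+ 2) by apply: Ex_ge0 => w; exact: sqr_ge0.
have q0 c' : 0 <= Ex (fun w => walsh c' w ^+ 4) by apply: Ex_ge0 => w; exact: exprn_even_ge0.
have ab0 : 0 <= Ex (fun w => walsh cA w ^+ 2 * walsh cB w ^+ 2).
  by apply: Ex_ge0 => w; rewrite mulr_ge0 ?sqr_ge0.
have t0 : 0 <= 3 ^+ d :> R by rewrite exprn_ge0.
have CS := Ex_CauchySchwarz (fun w => walsh cA w ^+ 2) (fun w => walsh cB w ^+ 2).
have q4 (G : cube -> R) : Ex (fun w => (G w ^+ 2) ^+ 2) = Ex (fun w => G w ^+ 4).
  by apply: eq_Ex => w; rewrite -exprM.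
rewrite !q4 in CS; rewrite (exprS 3 d) in HA *.
exact: two_point_pow4 t0 (sq0 _) (sq0 _) (q0 _) ab0 (q0 _) HA HB CS.
Qed.
End Cube.

(** * The Malliavin-Stein bound on the cube *)

Section SteinOnCube.
Variables (R : realFieldType) (n : nat).
Notation cube := {ffun 'I_n -> bool}.
Implicit Types (i j : 'I_n) (w : cube) (G H : cube -> R) (S U V : {set 'I_n})
  (c : {set 'I_n} -> R).

Definition homogeneous k c := forall S, c S != 0 -> #|S| = k.

Lemma eq_dif i G H w : G =1 H -> dif i G w = dif i H w.
Proof. by move=> GH; rewrite /dif !GH. Qed.

(** Unlike [walsh_dif], this keeps each coefficient at its own set; the sign disappears on squaring,
    so squares of differences expand directly in [c]. *)
Lemma dif_walshE i c w :
  dif i (walsh c) w = sgn R i w * walsh (fun S => (i \in S)%:R * c S) w.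
Proof.
rewrite /dif -mulrA; congr (_ * _); rewrite /walsh -sumrB mulr_suml.
apply: eq_bigr => S _; rewrite chi_flip; case: (i \in S) => /=; first by field.
by rewrite mul0r mul1r subrr !mul0r.
Qed.

Lemma euler_identity k c w : homogeneous k c ->
  \sum_i sgn R i w * dif i (walsh c) w = k%:R * walsh c w.
Proof.
move=> hc.
under eq_bigr => i _ do rewrite dif_walshE mulrA -expr2 sgn_sqr mul1r.
rewrite /walsh exchange_big mulr_sumr; apply: eq_bigr => S _ /=.
rewrite -!mulr_suml mulrA; congr (_ * _).
have [->|/hc <-] := eqVneq (c S) 0; first by rewrite !mulr0.
rewrite -sum1_card natr_sum [in RHS]big_mkcond; congr (_ * _).
by apply: eq_bigr => i _; case: (i \in S).
Qed.

Lemma homogeneous_dif k i c : homogeneous k c ->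
  homogeneous k.-1 (fun S => if i \in S then 0 else c (i |: S)).
Proof.
move=> hc S; case: ifPn => iS; first by rewrite eqxx.
by move=> /hc <-; rewrite cardsU1 iS.
Qed.

Lemma Ex_mul_homogeneous k c H : homogeneous k c ->
  k%:R * Ex (fun w => walsh c w * H w) =
  \sum_i Ex (fun w => dif i (walsh c) w * dif i H w).
Proof.
move=> hc; rewrite -ExZ.
under [RHS]eq_bigr => i _ do rewrite -(Ex_dual _ (fun w => dif_flip i _ w)).
rewrite -Ex_sum; apply: eq_Ex => w; rewrite mulrA -(euler_identity w hc).
by rewrite mulr_suml.
Qed.

Lemma sum_Ex_dif_sqr k c : homogeneous k c ->
  \sum_i Ex (fun w => dif i (walsh c) w ^+ 2) = k%:R * Ex (fun w => walsh c w ^+ 2).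
Proof.
move=> hc; under [in RHS]eq_Ex do rewrite expr2.
by rewrite (Ex_mul_homogeneous _ hc).
Qed.

Lemma homogeneous_hyper k c : homogeneous k c -> forall d, (k <= d)%N ->
  Ex (fun w => walsh c w ^+ 4) <= (3 ^+ d * Ex (fun w => walsh c w ^+ 2)) ^+ 2.
Proof.
move=> hc d kd; apply: (@hypercontractivity _ _ _ [set: 'I_n]) => S /hc Sk.
by rewrite finset.subsetT Sk.
Qed.

Section SteinKernel.
Variables (g : R -> R) (z p : R).
Hypotheses (p01 : 0 <= p <= 1) (tg_le1 : forall t, `|t * g t| <= 1).
Hypothesis tg_mono : forall a b : R, a <= b -> a * g a <= b * g b.
(** Stein's equation g' = t g(t) + 1(t <= z) - p integrated over [a, b], with the increasing term t
    g(t) and the decreasing indicator replaced by their values at the endpoints. *)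
Hypothesis g_incr : forall a b : R, a <= b ->
  (b - a) * (a * g a + (b <= z)%R%:R - p) <= g b - g a <=
  (b - a) * (b * g b + (a <= z)%R%:R - p).

(** [k] is the value that Stein's equation prescribes for g', at z as well. *)
Let k t := t * g t + (t <= z)%R%:R - p.
Let psi t := t * g t - (t <= z)%R%:R.

(** For a <= b both g b - g a and (b - a) k b lie in the interval of [g_incr], whose length is
    exactly (b - a) (psi b - psi a); exchanging the endpoints gives the other case. *)
Lemma stein_increment (a b : R) :
  `|g b - g a - (b - a) * k b| <= (b - a) * (psi b - psi a).
Proof.
have ind (x y : R) : x <= y -> (y <= z)%R%:R <= (x <= z)%R%:R :> R.
  by move=> xy; case: (leP y z) => [/(le_trans xy)->//|_]; rewrite ler0n.
rewrite /k /psi ler_norml.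
have [ab|/ltW ab] := leP a b; have := g_incr ab; have := ind _ _ ab;
  have := tg_mono ab; nra.
Qed.

(* Moving the difference operator off psi, which is bounded, is what avoids a
   third-moment term and works although g' jumps at z. *)
Lemma stein_cube q c (F := walsh c) : homogeneous q c ->
  q%:R * `|Ex (fun w => (F w <= z)%R%:R) - p| <=
  2 * Ex (fun w => `|q%:R - \sum_i dif i F w ^+ 2|) +
  4 * Ex (fun w => `|\sum_i sgn R i w * (`|dif i F w| * dif i F w)|).
Proof.
move=> hc.
have := Ex_mul_homogeneous (fun w => g (F w)) hc; rewrite -/F => Fg.
(* Adding and subtracting k(F) sum_i (D_i F)^2 separates the deviation of the squared gradient from
   q and the error of the discrete chain rule. *)
have E : q%:R * (Ex (fun w => (F w <= z)%R%:R) - p) =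
    Ex (fun w => k (F w) * (q%:R - \sum_i dif i F w ^+ 2)) +
    \sum_i Ex (fun w => dif i F w ^+ 2 * k (F w) -
                        dif i F w * dif i (fun w => g (F w)) w).
  have -> : Ex (fun w => (F w <= z)%R%:R) - p =
      Ex (fun w => k (F w)) - Ex (fun w => F w * g (F w)).
    by rewrite -{1}(Ex_cst n p) -!ExB; apply: eq_Ex => w; rewrite /k; ring.
  rewrite mulrBr Fg; under [X in _ = _ + X]eq_bigr => i _ do rewrite ExB.
  rewrite sumrB addrA; congr (_ - _); rewrite -Ex_sum -ExZ -ExD.
  apply: eq_Ex => w; rewrite -mulr_suml; ring.
have Dpsi i w : `|dif i F w ^+ 2 * k (F w) - dif i F w * dif i (fun w => g (F w)) w| <=
    2 * (`|dif i F w| * dif i F w * dif i (fun w => psi (F w)) w).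
  rewrite /dif; set a := F (flip i w); set b := F w.
  have sg := sgn_sqr R i w; have := stein_increment a b.
  have -> : (sgn R i w * (b - a) / 2) ^+ 2 * k b -
      sgn R i w * (b - a) / 2 * (sgn R i w * (g b - g a) / 2) =
      - (4^-1 * (b - a) * (g b - g a - (b - a) * k b)).
    transitivity (4^-1 * sgn R i w ^+ 2 * ((b - a) ^+ 2 * k b - (b - a) * (g b - g a))).
      by field.
    by rewrite sg; ring.
  have s1 : `|sgn R i w| = 1.
    by apply/eqP; rewrite -sqrp_eq1 // -normrX sg normr1.
  have h2 : 0 <= 2^-1 :> R by rewrite invr_ge0.
  have h4 : 0 <= 4^-1 :> R by rewrite invr_ge0.
  have -> : 2 * (`|sgn R i w * (b - a) / 2| * (sgn R i w * (b - a) / 2) *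
      (sgn R i w * (psi b - psi a) / 2)) =
      4^-1 * `|b - a| * (sgn R i w ^+ 2 * ((b - a) * (psi b - psi a))).
    rewrite !normrM s1 mul1r (ger0_norm h2); by field.
  rewrite sg mul1r normrN 2!normrM (ger0_norm h4) => h.
  by rewrite ler_wpM2l // mulr_ge0.
(* The bound on [k] becomes the constant 2 of the statement; the bound on [psi], times the 2 of
   [Dpsi], becomes the 4. *)
have k2 t : `|k t| <= 2.
  move: p01 (tg_le1 t); rewrite /k !ler_norml; case: (t <= z) => /=; lra.
have psi2 t : `|psi t| <= 2.
  move: (tg_le1 t); rewrite /psi !ler_norml; case: (t <= z) => /=; lra.
rewrite -[q%:R as X in X * _](ger0_norm (ler0n _ _)) -normrM E.
apply: le_trans (ler_normD _ _) _; apply: lerD.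
  apply: le_trans (normr_Ex _) _; rewrite -ExZ; apply: le_Ex => w.
  by rewrite normrM ler_wpM2r.
apply: le_trans (ler_norm_sum _ _ _) _.
have : \sum_i `|Ex (fun w => dif i F w ^+ 2 * k (F w) -
    dif i F w * dif i (fun w => g (F w)) w)| <=
    \sum_i 2 * Ex (fun w => sgn R i w * (`|dif i F w| * dif i F w) * psi (F w)).
  apply: ler_sum => i _; rewrite Ex_dual => [|w]; last by rewrite dif_flip.
  apply: le_trans (normr_Ex _) _; rewrite -ExZ; exact: le_Ex.
move/le_trans; apply; rewrite -mulr_sumr -Ex_sum -!ExZ.
apply: le_Ex => w; rewrite -mulr_suml.
set s := \sum_i _; have := psi2 (F w).
have : s * psi (F w) <= `|s| * `|psi (F w)| by rewrite -normrM ler_norm.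
have := normr_ge0 s; nra.
Qed.
End SteinKernel.

(** * Second moment of a discrete divergence *)

Section DivergenceMoment.
Variable u : 'I_n -> cube -> R.
Hypothesis ui : forall i w, u i (flip i w) = u i w.

Lemma dif_divergence i w :
  dif i (fun w => \sum_j sgn R j w * u j w) w =
  u i w + \sum_(j | j != i) sgn R j w * dif i (u j) w.
Proof.
rewrite {1}/dif (bigD1 i) //= [X in _ - X](bigD1 i) //= sgn_flip ui.
rewrite opprD addrACA -sumrB mulrDr mulrDl; congr (_ + _).
  transitivity (sgn R i w ^+ 2 * u i w); first by field.
  by rewrite sgn_sqr mul1r.
rewrite mulr_sumr mulr_suml; apply: eq_bigr => j ji.
by rewrite sgn_flip_neq // /dif; ring.
Qed.

(** Discrete Skorokhod isometry: two integrations by parts give the E u_i^2 and the cross terms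
    E[D_i u_j D_j u_i] for j != i, which are split by 2ab <= a^2 + b^2 and symmetrised. *)
Lemma Ex_divergence_sqr :
  Ex (fun w => (\sum_i sgn R i w * u i w) ^+ 2) <=
  \sum_i (Ex (fun w => u i w ^+ 2) + \sum_j Ex (fun w => dif j (u i) w ^+ 2)).
Proof.
have -> : Ex (fun w => (\sum_i sgn R i w * u i w) ^+ 2) =
    \sum_i (Ex (fun w => u i w ^+ 2) +
      \sum_(j | j != i) Ex (fun w => dif i (u j) w * dif j (u i) w)).
  under eq_Ex => w do rewrite expr2 mulr_suml.
  rewrite Ex_sum; apply: eq_bigr => i _; rewrite Ex_dual //.
  under eq_Ex => w do rewrite dif_divergence mulrDr -expr2 mulr_sumr.
  rewrite ExD Ex_sum; congr (_ + _); apply: eq_bigr => j ji.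
  rewrite -Ex_dual; last by move=> w; rewrite dif_flip_neq 1?eq_sym //; 
    rewrite /dif !ui.
  by apply: eq_Ex => w; ring.
have h : \sum_i \sum_(j | j != i) Ex (fun w => dif i (u j) w * dif j (u i) w) <=
    \sum_i \sum_j 2^-1 * (Ex (fun w => dif i (u j) w ^+ 2) + Ex (fun w => dif j (u i) w ^+ 2)).
  apply: ler_sum => i _; rewrite [X in _ <= X](bigID (fun j => j != i)) /=.
  apply: ler_wpDr.
    apply: sumr_ge0 => j _; apply: mulr_ge0; first by rewrite invr_ge0.
    by apply: addr_ge0; apply: Ex_ge0 => w; exact: sqr_ge0.
  apply: ler_sum => j _; rewrite -ExD -ExZ; apply: le_Ex => w.
  set a := dif _ _ _; set b := dif _ _ _; have := sqr_ge0 (a - b); nra.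
rewrite !big_split /= lerD2l; apply: le_trans h _.
pose A i j := Ex (fun w => dif j (u i) w ^+ 2).
have -> : \sum_i \sum_j 2^-1 * (Ex (fun w => dif i (u j) w ^+ 2) +
    Ex (fun w => dif j (u i) w ^+ 2)) =
    2^-1 * (\sum_i \sum_j A j i + \sum_i \sum_j A i j).
  rewrite -big_split mulr_sumr; apply: eq_bigr => i _.
  by rewrite -big_split mulr_sumr.
by rewrite [X in X + _]exchange_big /= le_eqVlt; apply/orP; left; apply/eqP; field.
Qed.
End DivergenceMoment.

(** The map x |-> |x| x obeys the Lipschitz bound |x - y| (|x| + |y|) although |x| is not smooth;
    the 2 comes from (|x| + |y|)^2 <= 2 (x^2 + y^2). *)
Lemma dif_abs_sqr_le i G w :
  dif i (fun w => `|G w| * G w) w ^+ 2 <=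
  2 * (dif i G w ^+ 2 * (G w ^+ 2 + G (flip i w) ^+ 2)).
Proof.
rewrite /dif; set x := G w; set y := G (flip i w).
rewrite !exprMn sgn_sqr !mul1r.
have h : (`|x| * x - `|y| * y) ^+ 2 <= (x - y) ^+ 2 * (2 * (x ^+ 2 + y ^+ 2)).
  have : `|x| * x - `|y| * y <= `|x - y| * (`|x| + `|y|) /\
         - (`|x| * x - `|y| * y) <= `|x - y| * (`|x| + `|y|).
    by case: (ger0P x); case: (ger0P y); case: (ger0P (x - y)); nra.
  have : (`|x| + `|y|) ^+ 2 <= 2 * (x ^+ 2 + y ^+ 2).
    rewrite -(real_normK (num_real x)) -(real_normK (num_real y)).
    by have := sqr_ge0 (`|x| - `|y|); lra.
  move=> h1 [h2 h3].
  have : `| `|x| * x - `|y| * y| <= `|x - y| * (`|x| + `|y|).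
    by rewrite ler_norml h2 andbT; lra.
  rewrite -(@ler_pXn2r _ 2) ?nnegrE ?mulr_ge0 ?addr_ge0 // real_normK ?num_real //.
  move=> /le_trans; apply.
  by rewrite exprMn real_normK ?num_real // ler_wpM2l ?sqr_ge0.
have : 0 <= (2^-1 : R) ^+ 2 by rewrite sqr_ge0.
nra.
Qed.

(** The divergence estimate is applied to u_i = |D_i F| D_i F. The mean of u_i^2 is the fourth
    moment of D_i F, of degree q - 1, whence 9^(q-1). The differences D_j u_i cost 4 by
    [dif_abs_sqr_le], again 9^(q-1) by Cauchy-Schwarz and hypercontractivity, and q - 1 because
    sum_j E (D_j D_i F)^2 = (q - 1) E (D_i F)^2. *)
Lemma skorokhod_term_bound q c (F := walsh c) : homogeneous q c ->
  Ex (fun w => (\sum_i sgn R i w * (`|dif i F w| * dif i F w)) ^+ 2) <=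
  9 ^+ q.-1 * (1 + 4 * q.-1%:R) * \sum_i Ex (fun w => dif i F w ^+ 2) ^+ 2.
Proof.
move=> hc.
apply: le_trans (Ex_divergence_sqr _) _; first by move=> i w; rewrite dif_flip.
rewrite mulr_sumr; apply: ler_sum => i _.
pose ci S := if i \in S then 0 else c (i |: S).
have hi : homogeneous q.-1 ci by apply: homogeneous_dif.
have E w : dif i F w = walsh ci w by exact: walsh_dif.
have m4 := homogeneous_hyper hi (leqnn _).
have -> : Ex (fun w => dif i F w ^+ 2) = Ex (fun w => walsh ci w ^+ 2).
  by apply: eq_Ex => w; rewrite E.
set m := Ex (fun w => walsh ci w ^+ 2) in m4 *.
have m0 : 0 <= m by apply: Ex_ge0 => w; rewrite sqr_ge0.
have t0 : 0 <= 3 ^+ q.-1 :> R by rewrite exprn_ge0.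
have -> : 9 ^+ q.-1 = 3 ^+ q.-1 ^+ 2 :> R.
  by rewrite -exprM mulnC exprM; congr (_ ^+ _); ring.
have -> : Ex (fun w => (`|dif i F w| * dif i F w) ^+ 2) = Ex (fun w => walsh ci w ^+ 4).
  by apply: eq_Ex => w; rewrite E exprMn real_normK ?num_real // -exprD.
have B j : Ex (fun w => dif j (fun w => `|dif i F w| * dif i F w) w ^+ 2) <=
    4 * (3 ^+ q.-1 * Ex (fun w => dif j (walsh ci) w ^+ 2) * (3 ^+ q.-1 * m)).
  pose H w := dif j (walsh ci) w ^+ 2 * walsh ci w ^+ 2.
  have : Ex (fun w => dif j (fun w => `|dif i F w| * dif i F w) w ^+ 2) <= 4 * Ex H.
    (* D_j D_i F is invariant under [flip j], so the term at the flipped point is H evaluated there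
       and has the same mean. *)
    have -> : 4 * Ex H = 2 * (Ex H + Ex (fun w => H (flip j w))) by rewrite Ex_flip; ring.
    rewrite -ExD -ExZ; apply: le_Ex => w.
    have -> : dif j (fun w => `|dif i F w| * dif i F w) w =
              dif j (fun w => `|walsh ci w| * walsh ci w) w.
      by apply: eq_dif => w'; rewrite E.
    apply: le_trans (dif_abs_sqr_le _ _ _) _.
    by rewrite /H dif_flip mulrDr.
  move/le_trans; apply; rewrite ler_wpM2l //.
  pose cj S := if j \in S then 0 else ci (j |: S).
  have hj : homogeneous q.-1.-1 cj by apply: homogeneous_dif.
  have Ej w : dif j (walsh ci) w = walsh cj w by exact: walsh_dif.
  have m4j := homogeneous_hyper hj (leq_pred _).
  have -> : Ex (fun w => dif j (walsh ci) w ^+ 2) = Ex (fun w => walsh cj w ^+ 2).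
    by apply: eq_Ex => w; rewrite Ej.
  have -> : Ex H = Ex (fun w => walsh cj w ^+ 2 * walsh ci w ^+ 2).
    by apply: eq_Ex => w; rewrite /H Ej.
  have CS := Ex_CauchySchwarz (fun w => walsh cj w ^+ 2) (fun w => walsh ci w ^+ 2).
  have q4 (G : cube -> R) : Ex (fun w => (G w ^+ 2) ^+ 2) = Ex (fun w => G w ^+ 4).
    by apply: eq_Ex => w; rewrite -exprM.
  rewrite !q4 in CS.
  rewrite -(@ler_pXn2r _ 2) // ?nnegrE.
  - rewrite [X in _ <= X]exprMn; apply: le_trans CS _; apply: ler_pM => //;
    by apply: Ex_ge0 => w; exact: exprn_even_ge0.
  - by apply: Ex_ge0 => w; rewrite mulr_ge0 ?sqr_ge0.
  - by apply: mulr_ge0; apply: mulr_ge0 => //; apply: Ex_ge0 => w; rewrite sqr_ge0.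
have := @ler_sum _ _ (index_enum 'I_n) xpredT _ _ (fun j _ => B j).
have -> : \sum_j 4 * (3 ^+ q.-1 * Ex (fun w => dif j (walsh ci) w ^+ 2) * (3 ^+ q.-1 * m)) =
    4 * (3 ^+ q.-1 * (q.-1%:R * m) * (3 ^+ q.-1 * m)).
  by rewrite -(sum_Ex_dif_sqr hi) mulr_sumr mulr_suml mulr_sumr.
move=> h.
by apply: le_trans (lerD m4 h) _; rewrite le_eqVlt; apply/orP; left; apply/eqP; ring.
Qed.
End SteinOnCube.

(** * The variance of sum_i (D_i F)^2 *)

Lemma sqr_sum_le_card (R : realFieldType) (I : finType) (Q : pred I) (a : I -> R) :
  (\sum_(i | Q i) a i) ^+ 2 <= #|Q|%:R * \sum_(i | Q i) a i ^+ 2.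
Proof.
have := sum_CauchySchwarz (index_enum I) Q (fun=> 1) a.
under eq_bigr do rewrite mul1r.
by under [X in _ <= X * _ -> _]eq_bigr do rewrite expr1n; rewrite sumr_const.
Qed.

Section CarreDuChamp.
Variables (R : realFieldType) (n q : nat).
Notation cube := {ffun 'I_n -> bool}.
Implicit Types (i j : 'I_n) (w : cube) (S U V A B I : {set 'I_n}).
Variable c : {set 'I_n} -> R.
Hypothesis hc : homogeneous q c.

(** The weight is the number of coordinates i whose squared difference contributes the product of
    the two coefficients, since D_i keeps the sets containing i. *)
Let h (p : {set 'I_n} * {set 'I_n}) : R :=
  #|p.1 :&: p.2|%:R * (c p.1 * c p.2).
Let gam U : R := \sum_(p | symd p.1 p.2 == U) h p.

Lemma sum_dif_sqr_walsh w : \sum_i dif i (walsh c) w ^+ 2 = walsh gam w.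
Proof.
transitivity (\sum_i \sum_(p : {set 'I_n} * {set 'I_n})
    (i \in p.1 :&: p.2)%:R * (c p.1 * c p.2 * chi R (symd p.1 p.2) w)).
  apply: eq_bigr => i _; rewrite dif_walshE exprMn sgn_sqr mul1r walsh_sqr.
  rewrite pair_bigA /=; apply: eq_bigr => -[S U] _ /=; rewrite inE.
  by case: (i \in S); case: (i \in U); rewrite /= ?mul0r ?mul1r ?mulr0 ?mul0r.
rewrite exchange_big /walsh /gam (partition_big (fun p => symd p.1 p.2) xpredT) //=.
apply: eq_bigr => U _; rewrite mulr_suml; apply: eq_bigr => p /eqP pU.
rewrite -mulr_suml pU !mulrA -mulrA -mulrA /h -!mulrA; congr (_ * _).
rewrite -sum1_card natr_sum [in RHS]big_mkcond.
by apply: eq_bigr => i _; case: (i \in _).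
Qed.

Let K A B : R := \sum_(p | (p.1 :\: p.2 == A) && (p.2 :\: p.1 == B)) h p.

(** Set form of [f *_r^r f]: the contracted block I is unordered, whence a factor r! in the
    comparison with sums over tuples. *)
Definition contr (r : nat) A B : R :=
  \sum_(I : {set 'I_n} | (#|I| == r)%N && [disjoint I & A :|: B]) c (A :|: I) * c (B :|: I).

Let KE A B : [disjoint A & B] ->
  K A B = \sum_(I : {set 'I_n} | [disjoint I & A :|: B]) #|I|%:R * (c (A :|: I) * c (B :|: I)).
Proof.
move=> /pred0P AB.
have {}AB x : (x \in A) && (x \in B) = false by have := AB x.
rewrite /K (reindex_onto (fun I => (A :|: I, B :|: I)) (fun p => p.1 :&: p.2)) /=; last first.
  case=> S U /= /andP[/eqP <- /eqP <-]; congr (_, _); apply/setP => x; rewrite !inE;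
  by case: (x \in S); case: (x \in U).
have E I : (((A :|: I) :\: (B :|: I) == A) && ((B :|: I) :\: (A :|: I) == B)) &&
     ((A :|: I) :&: (B :|: I) == I) = [disjoint I & A :|: B].
  apply/idP/idP => [/andP[/andP[/eqP e1 /eqP e2] _]|/pred0P d].
    apply/pred0P => x /=; move/setP/(_ x) : e1; move/setP/(_ x) : e2; rewrite !inE.
    by case: (x \in A); case: (x \in B); case: (x \in I).
  apply/andP; split; first (apply/andP; split); apply/eqP/setP => x;
    have := d x; have := AB x; rewrite /= !inE;
    by case: (x \in A); case: (x \in B); case: (x \in I).
under eq_bigl => I do rewrite E.
apply: eq_bigr => I /pred0P d; rewrite /h /=; congr (#|pred_of_set _|%:R * _).
by apply/setP => x; have := d x; have := AB x; rewrite /= !inE;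
  case: (x \in A); case: (x \in B); case: (x \in I).
Qed.

(** By homogeneity every contributing I has the same size r = q - #|A| = q - #|B|, so a single r
    matters, and the factor #|I| = r is bounded by q. *)
Let K_le A B : [disjoint A & B] -> A :|: B != finset.set0 ->
  K A B ^+ 2 <= q%:R ^+ 2 *
    \sum_(1 <= r < q) ((#|A| == q - r) && (#|B| == q - r))%N%:R * contr r A B ^+ 2.
Proof.
move=> AB U0; rewrite KE //.
have t0 r : 0 <= ((#|A| == q - r) && (#|B| == q - r))%N%:R * contr r A B ^+ 2.
  by rewrite mulr_ge0 ?sqr_ge0.
have s0 : 0 <= q%:R ^+ 2 * \sum_(1 <= r < q)
    ((#|A| == q - r) && (#|B| == q - r))%N%:R * contr r A B ^+ 2.
  by rewrite mulr_ge0 ?sqr_ge0 // sumr_ge0.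
have nz I : [disjoint I & A :|: B] -> #|I|%:R * (c (A :|: I) * c (B :|: I)) != 0 ->
    [/\ (0 < #|I|)%N, (#|A| + #|I| = q)%N & (#|B| + #|I| = q)%N].
  move=> dI; rewrite mulf_eq0 pnatr_eq0 negb_or lt0n => /andP[-> ].
  rewrite mulf_eq0 negb_or => /andP[/hc cA /hc cB].
  move: dI; rewrite -finset.setI_eq0 finset.setIUr finset.setU_eq0 ![I :&: _]finset.setIC.
  move=> /andP[/eqP dA /eqP dB].
  by split=> //; [rewrite -cA|rewrite -cB]; rewrite cardsU ?dA ?dB cards0 subn0.
have [/existsP[I0 /andP[d0 n0]]|/existsPn no] := boolP [exists I : {set 'I_n},
    [disjoint I & A :|: B] && (#|I|%:R * (c (A :|: I) * c (B :|: I)) != 0)]; last first.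
  rewrite big1 ?expr0n //= => I dI; apply/eqP.
  by have := no I; rewrite dI negbK.
have [I0p cA cB] := nz _ d0 n0; set r := #|I0| in I0p cA cB.
(* r = q would leave both A and B empty. *)
have rq : (r < q)%N.
  rewrite ltn_neqAle -{2}cA leq_addl andbT; apply: contra U0 => /eqP rq.
  move: cA cB; rewrite rq -[RHS]add0n => /addIn/eqP; rewrite cards_eq0 => /eqP ->.
  by rewrite -[RHS]add0n => /addIn/eqP; rewrite cards_eq0 => /eqP ->; rewrite finset.setU0.
rewrite (bigD1_seq r) ?iota_uniq ?mem_index_iota ?I0p //=.
have -> : \sum_(I : {set 'I_n} | [disjoint I & A :|: B]) #|I|%:R * (c (A :|: I) * c (B :|: I)) =
    r%:R * contr r A B.
  rewrite /contr mulr_sumr (bigID (fun I => #|I| == r)) /= [X in _ + X]big1 ?addr0.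
    by apply: eq_big => I; [rewrite andbC|case/andP => _ /eqP ->].
  move=> I /andP[dI Ir]; apply/eqP; apply: contraNT Ir => /(nz _ dI)[_ + _].
  by rewrite -cA => /addnI ->.
have -> : (#|A| == q - r)%N by rewrite -cA addnK.
have -> : (#|B| == q - r)%N by rewrite -cB addnK.
rewrite /= mul1r exprMn.
rewrite mulrDr ler_wpDr ?mulr_ge0 ?sqr_ge0 ?sumr_ge0 //.
by rewrite ler_wpM2r ?sqr_ge0 // ler_sqr ?nnegrE ?ler0n // ler_nat ltnW.
Qed.

Let gamE U : gam U = \sum_(p | (p.1 :|: p.2 == U) && [disjoint p.1 & p.2]) K p.1 p.2.
Proof.
rewrite /gam (partition_big (fun p => (p.1 :\: p.2, p.2 :\: p.1))
    (fun p => (p.1 :|: p.2 == U) && [disjoint p.1 & p.2])) /=; last first.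
  move=> [S T] /= ST; apply/andP; split=> //.
  by apply/pred0P => x /=; rewrite !inE; case: (x \in S); case: (x \in T).
apply: eq_bigr => -[A B] /= /andP[/eqP AB _]; apply: eq_bigl => -[S T] /=.
rewrite xpair_eqE andbC; case: (S :\: T =P A) => //= SA.
by case: (T :\: S =P B) => //= TB; rewrite /symd SA TB AB eqxx.
Qed.

(** [gam U] runs over the ordered splittings of U into two disjoint sets, at most 2^#|U| of them,
    and vanishes unless #|U| <= 2 q; Cauchy-Schwarz then costs 4^q. *)
Let gam_le U : U != finset.set0 ->
  gam U ^+ 2 <= (4 ^ q)%:R *
    \sum_(p | (p.1 :|: p.2 == U) && [disjoint p.1 & p.2]) K p.1 p.2 ^+ 2.
Proof.
move=> U0.
have s0 : 0 <= \sum_(p | (p.1 :|: p.2 == U) && [disjoint p.1 & p.2]) K p.1 p.2 ^+ 2.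
  by apply: sumr_ge0 => p _; exact: sqr_ge0.
have [U2q|U2q] := leqP #|U| (2 * q); last first.
  rewrite /gam big1 ?expr0n ?mulr_ge0 ?ler0n //= => -[S T] /= /eqP ST.
  have : (#|S| + #|T| != q + q)%N.
    apply: contraTneq U2q => e; rewrite -leqNgt mul2n -addnn -e -ST.
    apply: leq_trans (leq_card_setU _ _) _.
    by rewrite leq_add // subset_leq_card // finset.subsetDl.
  rewrite /h /=; have [->|/hc ->] := eqVneq (c S) 0; first by rewrite mul0r mulr0.
  have [->|/hc ->] := eqVneq (c T) 0; first by rewrite !mulr0.
  by rewrite eqxx.
rewrite gamE; apply: le_trans (sqr_sum_le_card _ _) _; rewrite ler_wpM2r // ler_nat.
have -> : (4 ^ q = 2 ^ (2 * q))%N by rewrite expnM.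
apply: leq_trans (_ : #|powerset U| <= _)%N; last by rewrite card_powerset leq_pexp2l.
set Q := (X in #|X|).
rewrite -(card_in_imset (f := fun p : {set 'I_n} * {set 'I_n} => p.1) (D := Q)).
  apply/subset_leq_card/fintype.subsetP => _ /imsetP[[S T] /andP[/eqP <- _] ->].
  by rewrite inE finset.subsetUl.
move=> [S T] [S' T'] /andP[/= /eqP e1 /pred0P d] /andP[/= /eqP e2 /pred0P d'] /= SS.
have e : S' :|: T' = S :|: T by rewrite e1 e2.
subst S'; congr (_, _); apply/setP => x; have := d x; have := d' x; move/setP/(_ x) : e.
by rewrite /= !inE; case: (x \in S); case: (x \in T); case: (x \in T').
Qed.

(** The Walsh coefficient at the empty set is the mean q sum_S c S^2; deleting it and applying
    Parseval leaves the sum of the other [gam U ^+ 2]. *)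
Lemma Ex_carre_du_champ_var :
  Ex (fun w => (\sum_i dif i (walsh c) w ^+ 2 - q%:R * \sum_S c S ^+ 2) ^+ 2) <=
  (4 ^ q)%:R * (q%:R ^+ 2 * \sum_(1 <= r < q)
    \sum_(p : {set 'I_n} * {set 'I_n} |
       [&& [disjoint p.1 & p.2], #|p.1| == q - r & #|p.2| == q - r]%N)
     contr r p.1 p.2 ^+ 2).
Proof.
have g0 : gam finset.set0 = q%:R * \sum_S c S ^+ 2.
  rewrite /gam mulr_sumr (reindex_onto (fun S => (S, S)) fst) /=; last first.
    by move=> [S T] /=; rewrite symd_eq0 => /eqP ->.
  apply: eq_big => [S|S _]; first by rewrite symd_eq0 !eqxx.
  rewrite /h /= finset.setIid -expr2.
  by have [->|/hc->//] := eqVneq (c S) 0; rewrite expr0n !mulr0.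
have -> : Ex (fun w => (\sum_i dif i (walsh c) w ^+ 2 - q%:R * \sum_S c S ^+ 2) ^+ 2) =
    Ex (fun w => walsh (fun U => if U == finset.set0 then 0 else gam U) w ^+ 2).
  apply: eq_Ex => w; congr (_ ^+ 2); rewrite sum_dif_sqr_walsh -g0 /walsh.
  rewrite (bigD1 finset.set0) //= [RHS](bigD1 finset.set0) //= eqxx mul0r add0r.
  rewrite {1}/chi big_set0 mulr1 addrAC subrr add0r.
  by apply: eq_bigr => U /negbTE ->.
rewrite Ex_walsh_sqr (bigD1 finset.set0) //= eqxx expr0n add0r.
have -> : \sum_(U | U != finset.set0) (if U == finset.set0 then 0 else gam U) ^+ 2 =
    \sum_(U | U != finset.set0) gam U ^+ 2 by apply: eq_bigr => U /negbTE ->.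
apply: (@le_trans _ _ (\sum_(U | U != finset.set0) (4 ^ q)%:R *
    \sum_(p | (p.1 :|: p.2 == U) && [disjoint p.1 & p.2]) K p.1 p.2 ^+ 2)).
  by apply: ler_sum => U; exact: gam_le.
rewrite -mulr_sumr ler_wpM2l ?ler0n //.
apply: le_trans (_ : \sum_(p : {set 'I_n} * {set 'I_n} |
    [disjoint p.1 & p.2] && (p.1 :|: p.2 != finset.set0)) K p.1 p.2 ^+ 2 <= _).
  rewrite [leRHS](partition_big (fun p => p.1 :|: p.2)
    (fun U => U != finset.set0)) /=; last first.
    by move=> p /andP[].
  apply: ler_sum => U U0; rewrite le_eqVlt; apply/orP; left; apply/eqP.
  apply: eq_bigl => p; case: eqP => [->|]; last by rewrite andbF.
  by rewrite U0 /= !andbT.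
apply: (@le_trans _ _ (\sum_(p : {set 'I_n} * {set 'I_n} |
    [disjoint p.1 & p.2] && (p.1 :|: p.2 != finset.set0)) q%:R ^+ 2 *
    \sum_(1 <= r < q) ((#|p.1| == q - r) && (#|p.2| == q - r))%N%:R *
      contr r p.1 p.2 ^+ 2)).
  by apply: ler_sum => p /andP[]; exact: K_le.
rewrite -mulr_sumr ler_wpM2l ?sqr_ge0 // exchange_big /=.
apply: ler_sum => r _.
rewrite [X in _ <= X]big_mkcond [X in X <= _]big_mkcond; apply: ler_sum => p _.
have : 0 <= contr r p.1 p.2 ^+ 2 by exact: sqr_ge0.
case: [disjoint _ & _] => //=; case: (_ != _); case: (_ == _)%N; case: (_ == _)%N => /=;
  by rewrite ?mul1r ?mul0r.
Qed.

Lemma Ex_norm_le (G : cube -> R) x : 0 <= x -> Ex (fun w => G w ^+ 2) <= x ^+ 2 ->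
  Ex (fun w => `|G w|) <= x.
Proof.
move=> x0 h2; rewrite -(@ler_pXn2r _ 2) ?nnegrE //; last exact: Ex_ge0.
have := Ex_CauchySchwarz (fun w => `|G w|) (fun=> 1).
under eq_Ex do rewrite mulr1.
under [X in _ * X]eq_Ex do rewrite expr1n.
rewrite Ex_cst mulr1 => /le_trans; apply.
by under eq_Ex do rewrite real_normK ?num_real //.
Qed.

Section Bound.
Variables (g : R -> R) (z p s t : R).
Hypotheses (p01 : 0 <= p <= 1) (tg_le1 : forall t, `|t * g t| <= 1).
Hypothesis tg_mono : forall a b : R, a <= b -> a * g a <= b * g b.
Hypothesis g_incr : forall a b : R, a <= b ->
  (b - a) * (a * g a + (b <= z)%R%:R - p) <= g b - g a <=
  (b - a) * (b * g b + (a <= z)%R%:R - p).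
Hypotheses (q0 : (0 < q)%N) (s0 : 0 <= s) (t0 : 0 <= t).
Hypothesis s_bound : \sum_(1 <= r < q)
    \sum_(p : {set 'I_n} * {set 'I_n} |
       [&& [disjoint p.1 & p.2], #|p.1| == q - r & #|p.2| == q - r]%N)
     contr r p.1 p.2 ^+ 2 <= s ^+ 2.
Hypothesis t_bound : \sum_i (\sum_(S : {set 'I_n} | i \in S) c S ^+ 2) ^+ 2 <= t ^+ 2.

(** The Stein bound is divided by q. The triangle inequality around the mean of the squared gradient
    gives the first two terms, the variance factor 4^q q^2 becoming 2^q q; in the last term 9^(q-1)
    (1 + 4 (q - 1)) is enlarged to the square of 3^q (1 + 4 q). *)
Lemma kolmogorov_cube :
  `|Ex (fun w => (walsh c w <= z)%R%:R) - p| <=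
  2 * `|1 - \sum_S c S ^+ 2| + 2 ^+ q.+1 * s + 4 * 3 ^+ q * (1 + 4 * q%:R) * t.
Proof.
have Q0 : 0 < q%:R :> R by rewrite ltr0n.
have Q1 : 1 <= q%:R :> R by rewrite ler1n.
have pow0 k : 0 <= 3 ^+ k :> R by rewrite exprn_ge0.
have pow2 k : 0 <= 2 ^+ k :> R by rewrite exprn_ge0.
rewrite -(ler_pM2l Q0).
apply: le_trans (stein_cube p01 tg_le1 tg_mono g_incr hc) _.
have e1 : Ex (fun w => `|q%:R - \sum_i dif i (walsh c) w ^+ 2|) <=
    q%:R * `|1 - \sum_S c S ^+ 2| + 2 ^+ q * q%:R * s.
  have := @Ex_norm_le (fun w => \sum_i dif i (walsh c) w ^+ 2 - q%:R * \sum_S c S ^+ 2)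
    (2 ^+ q * q%:R * s).
  move=> /(_ (mulr_ge0 (mulr_ge0 (pow2 _) (ltW Q0)) s0)) H.
  have {H}: Ex (fun w => `|\sum_i dif i (walsh c) w ^+ 2 - q%:R * \sum_S c S ^+ 2|) <=
      2 ^+ q * q%:R * s.
    apply: H; apply: le_trans Ex_carre_du_champ_var _.
    have -> : (2 ^+ q * q%:R * s) ^+ 2 = (4 ^ q)%:R * (q%:R ^+ 2 * s ^+ 2).
      rewrite !exprMn -mulrA natrX; congr (_ * _).
      by rewrite -exprM mulnC exprM; congr (_ ^+ _); ring.
    by rewrite ler_wpM2l ?ler0n // ler_wpM2l ?sqr_ge0.
  rewrite -(lerD2l (q%:R * `|1 - \sum_S c S ^+ 2|)); apply: le_trans.
  rewrite -{1}(Ex_cst n (_ * `|_|)) -ExD; apply: le_Ex => w.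
  set a := \sum_i _; set b := \sum_S _.
  have -> : q%:R * `|1 - b| = `|q%:R * (1 - b)| by rewrite normrM (ger0_norm (ltW Q0)).
  have -> : q%:R - a = q%:R * (1 - b) - (a - q%:R * b) by ring.
  exact: ler_normB.
have w0 : 0 <= 1 + 4 * q%:R :> R by have := ltW Q0; lra.
have w1 : 0 <= 1 + 4 * q.-1%:R :> R by have := ler0n R q.-1; lra.
have x1 : 0 <= 3 ^+ q * (1 + 4 * q%:R) * t by exact: mulr_ge0 (mulr_ge0 (pow0 _) w0) t0.
have e2 : Ex (fun w => `|\sum_i sgn R i w * (`|dif i (walsh c) w| * dif i (walsh c) w)|) <=
    3 ^+ q * (1 + 4 * q%:R) * t.
  apply: (Ex_norm_le x1).
  apply: le_trans (skorokhod_term_bound hc) _.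
  rewrite exprMn; apply: ler_pM.
  - by apply: mulr_ge0 w1; rewrite exprn_ge0.
  - by apply: sumr_ge0 => i _; exact: sqr_ge0.
  - have -> : (3 ^+ q * (1 + 4 * q%:R)) ^+ 2 = 9 ^+ q * (1 + 4 * q%:R) ^+ 2 :> R.
      by rewrite exprMn -exprM mulnC exprM; congr (_ ^+ _ * _); ring.
    apply: ler_pM w1 _ _; first by rewrite exprn_ge0.
      by rewrite ler_weXn2l ?leq_pred // ler1n.
    have : q.-1%:R <= q%:R :> R by rewrite ler_nat leq_pred.
    nra.
  apply: le_trans t_bound; apply: ler_sum => i _.
  rewrite ler_sqr ?nnegrE; first last.
  - by apply: sumr_ge0 => S _; exact: sqr_ge0.
  - by apply: Ex_ge0 => w; exact: sqr_ge0.
  have -> : Ex (fun w => dif i (walsh c) w ^+ 2) =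
      Ex (fun w => walsh (fun S => (i \in S)%:R * c S) w ^+ 2).
    by apply: eq_Ex => w; rewrite dif_walshE exprMn sgn_sqr mul1r.
  rewrite Ex_walsh_sqr [X in _ <= X]big_mkcond; apply: ler_sum => S _.
  by case: (i \in S); rewrite ?mul1r // mul0r expr0n.
rewrite exprS; nra.
Qed.
End Bound.
End CarreDuChamp.

Local Open Scope classical_set_scope.
Local Open Scope ring_scope.

(** * Stein's equation for the Gaussian distribution function *)

Section MeanValue.
Variable R : realType.

Lemma mean_value (f df : R -> R) (a b : R) : a <= b ->
  (forall x : R, is_derive x (1 : R) f (df x)) ->
  exists2 c, a <= c <= b & f b - f a = df c * (b - a).
Proof.
move=> ab fdf; have [] := @MVT_segment R f df a b ab (fun x _ => fdf x).
  apply: continuous_subspaceT => x; apply: differentiable_continuous.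
  by apply/derivable1_diffP; case: (fdf x).
by move=> c; rewrite in_itv /= => cab E; exists c.
Qed.

Lemma derive_ge0_homo (f df : R -> R) :
  (forall x : R, is_derive x (1 : R) f (df x)) ->
  (forall x, 0 <= df x) -> {homo f : x y / x <= y}.
Proof.
move=> fdf df0 x y xy; have [c _ E] := mean_value xy fdf.
by rewrite -subr_ge0 E mulr_ge0 // subr_ge0.
Qed.

End MeanValue.

(** * Mills ratio bounds *)

Section MillsRatio.
(** [Q] is an abstract tail, later instantiated by 1 - Phi(t) and, through the symmetry of [phi], by
    Phi(-t). *)
Variables (R : realType) (phi Q : R -> R).
Hypothesis phi_gt0 : forall x, 0 < phi x.
Hypothesis dphi : forall x : R, is_derive x (1 : R) phi (- x * phi x).
Hypothesis dQ : forall x : R, is_derive x (1 : R) Q (- phi x).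
Hypothesis Q_ge0 : forall x, 0 <= Q x.
Hypothesis Q_small : forall e : R, 0 < e -> exists M : R, forall x, M <= x -> Q x < e.

(** With the factor x > 0 frozen, phi(t) - x Q(t) decreases for t >= x; were it negative at x, it
    would stay away from 0, but it is at least -x Q(t), which tends to 0. *)
Lemma mills_upper x : x * Q x <= phi x.
Proof.
have [x0|x0] := leP x 0; first by have := Q_ge0 x; have := phi_gt0 x; nra.
rewrite -subr_ge0 leNgt; apply/negP => G0.
pose G t := phi t - x * Q t.
have dG (t : R) : is_derive t (1 : R) G ((x - t) * phi t).
  by apply: trigger_derive; rewrite /GRing.scale /=; ring.
have e0 : 0 < - G x by rewrite oppr_gt0.
have [M QM] := Q_small (divr_gt0 e0 x0).
have Mx : x <= Num.max M x by rewrite le_max lexx orbT.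
have [c /andP[xc _] E] := mean_value Mx dG.
have := QM (Num.max M x); rewrite le_max lexx => /(_ isT); rewrite ltr_pdivlMr //.
have := phi_gt0 (Num.max M x).
have : (x - c) * phi c * (Num.max M x - x) <= 0.
  rewrite mulr_le0_ge0 ?subr_ge0 // mulr_le0_ge0 ?subr_le0 //; exact: ltW.
rewrite -E /G; lra.
Qed.

Let phi_tail x : 2 <= x -> x ^+ 2 * phi x <= 4 * phi 2.
Proof.
move=> x2; pose G t := t ^+ 2 * phi t.
have dG (t : R) : is_derive t (1 : R) G (t * (2 - t ^+ 2) * phi t).
  by apply: trigger_derive; rewrite /GRing.scale /=; ring.
have [c /andP[c2 _]] := mean_value x2 dG; rewrite /G => E.
have : c * (2 - c ^+ 2) * phi c * (x - 2) <= 0.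
  rewrite mulr_le0_ge0 ?subr_ge0 // mulr_le0_ge0 ?(ltW (phi_gt0 _)) //.
  by rewrite mulr_ge0_le0 //; nra.
rewrite -E; lra.
Qed.

(* t^2 phi(t) decreases beyond sqrt 2, so t phi(t) -> 0 without exp bounds. *)
Lemma mills_lower x : x * phi x <= (1 + x ^+ 2) * Q x.
Proof.
rewrite -subr_ge0 leNgt; apply/negP => G0.
pose G t := (1 + t ^+ 2) * Q t - t * phi t.
have dG (t : R) : is_derive t (1 : R) G (2 * (t * Q t - phi t)).
  by apply: trigger_derive; rewrite /GRing.scale /=; ring.
set e := - G x; have e0 : 0 < e by rewrite oppr_gt0.
(* [mills_upper] makes G decreasing, so G y <= - e forces y phi(y) >= e, whereas [phi_tail] gives y
   phi(y) < e for y > 4 phi(2) / e. *)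
pose y := Num.max x (Num.max 2 (4 * phi 2 / e + 1)).
have yx : x <= y by rewrite le_max lexx.
have y2 : 2 <= y by rewrite !le_max lexx orbT.
have yb : 4 * phi 2 / e < y by rewrite !lt_max ltrDl ltr01 !orbT.
have [c _ E] := mean_value yx dG.
have Gy : G y <= - e.
  have : 2 * (c * Q c - phi c) * (y - x) <= 0.
    by rewrite mulr_le0_ge0 ?subr_ge0 // mulr_ge0_le0 // subr_le0 mills_upper.
  rewrite -E /e; lra.
have ye : e <= y * phi y.
  have : 0 <= (1 + y ^+ 2) * Q y by rewrite mulr_ge0 // addr_ge0 // sqr_ge0.
  move: Gy; rewrite /G; lra.
have := phi_tail y2; rewrite ltr_pdivrMr // in yb.
nra.
Qed.
End MillsRatio.

Section SteinSolution.
Variables (R : realType) (phi phiV Phi : R -> R).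
Hypothesis phi_gt0 : forall x, 0 < phi x.
Hypothesis phiK : forall x, phi x * phiV x = 1.
Hypothesis dphi : forall x : R, is_derive x (1 : R) phi (- x * phi x).
Hypothesis dphiV : forall x : R, is_derive x (1 : R) phiV (x * phiV x).
Hypothesis phiN : forall x, phi (- x) = phi x.
Hypothesis dPhi : forall x : R, is_derive x (1 : R) Phi (phi x).
Hypothesis Phi01 : forall x, 0 <= Phi x <= 1.
Hypothesis Phi_y : forall e : R, 0 < e -> exists M : R, forall x, M <= x -> 1 - Phi x < e.
Hypothesis Phi_Ny : forall e : R, 0 < e -> exists M : R, forall x, M <= x -> Phi (- x) < e.

Let dU (x : R) : is_derive x (1 : R) (fun t => 1 - Phi t) (- phi x).
Proof. by apply: trigger_derive; rewrite add0r mul1r. Qed.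

Let dL (x : R) : is_derive x (1 : R) (fun t => Phi (- t)) (- phi x).
Proof.
have := @is_derive1_comp R Phi (@GRing.opp R) x _ _ (dPhi (- x)) _.
move=> /(_ _ (is_deriveNid _ _)); rewrite phiN => h.
by apply: is_derive_eq; rewrite /GRing.scale /= mulrN1.
Qed.
Let U_ge0 x : 0 <= 1 - Phi x. Proof. by case/andP: (Phi01 x); rewrite subr_ge0. Qed.
Let L_ge0 x : 0 <= Phi (- x). Proof. by case/andP: (Phi01 (- x)). Qed.
Let U1 t : t * (1 - Phi t) <= phi t.
Proof. exact: (mills_upper phi_gt0 dphi dU U_ge0 Phi_y). Qed.
Let U2 t : t * phi t <= (1 + t ^+ 2) * (1 - Phi t).
Proof. exact: (mills_lower phi_gt0 dphi dU U_ge0 Phi_y). Qed.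
Let L1 t : - t * Phi t <= phi t.
Proof.
by have := mills_upper phi_gt0 dphi dL L_ge0 Phi_Ny (- t); rewrite phiN opprK.
Qed.
Let L2 t : - t * phi t <= (1 + t ^+ 2) * Phi t.
Proof.
by have := mills_lower phi_gt0 dphi dL L_ge0 Phi_Ny (- t); rewrite phiN opprK sqrrN.
Qed.

Let phiV_gt0 x : 0 < phiV x.
Proof. by have := phiK x; have := phi_gt0 x; nra. Qed.

Let G1 t := Phi t * phiV t.
Let G2 t := (1 - Phi t) * phiV t.

Let dG1 (t : R) : is_derive t (1 : R) G1 (1 + t * G1 t).
Proof.
apply: trigger_derive; rewrite /GRing.scale /= /G1.
by have := phiK t; lra.
Qed.

Let dG2 (t : R) : is_derive t (1 : R) G2 (- 1 + t * G2 t).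
Proof.
apply: trigger_derive; rewrite /GRing.scale /= /G2.
by have := phiK t; lra.
Qed.

(** The derivative t + (1 + t^2) G1(t) is nonnegative by the lower Mills bound for the left tail;
    [tG2_homo] uses the right tail in the same way. *)
Let tG1_homo : {homo (fun t => t * G1 t) : x y / x <= y}.
Proof.
apply: (derive_ge0_homo (df := fun t => G1 t + t * (1 + t * G1 t))) => t.
  by apply: (trigger_derive (is_deriveM (is_derive_id t (1 : R)) (dG1 t)));
    rewrite /GRing.scale /=; ring.
have := L2 t; have := phiK t; have := phiV_gt0 t; rewrite /G1 => h1 h2 h3.
have : - t * (phi t * phiV t) <= (1 + t ^+ 2) * (Phi t * phiV t).
  by rewrite !mulrA ler_wpM2r // ltW.
by rewrite h2; lra.
Qed.

Let tG2_homo : {homo (fun t => t * G2 t) : x y / x <= y}.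
Proof.
apply: (derive_ge0_homo (df := fun t => G2 t + t * (- 1 + t * G2 t))) => t.
  by apply: (trigger_derive (is_deriveM (is_derive_id t (1 : R)) (dG2 t)));
    rewrite /GRing.scale /=; ring.
have := U2 t; have := phiK t; have := phiV_gt0 t; rewrite /G2 => h1 h2 h3.
have : t * (phi t * phiV t) <= (1 + t ^+ 2) * ((1 - Phi t) * phiV t).
  by rewrite !mulrA ler_wpM2r // ltW.
by rewrite h2; lra.
Qed.

Let tG1_ge t : - 1 <= t * G1 t.
Proof.
have : - t * Phi t * phiV t <= phi t * phiV t by rewrite ler_wpM2r // ltW.
by rewrite phiK /G1; lra.
Qed.

Let tG2_le t : t * G2 t <= 1.
Proof.
have : t * (1 - Phi t) * phiV t <= phi t * phiV t by rewrite ler_wpM2r // ltW.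
by rewrite phiK /G2; lra.
Qed.

Variable z : R.
Let p := Phi z.

(** The classical bounded solution of Stein's equation. [G1] = Phi / phi and [G2] = (1 - Phi) / phi
    solve G' = t G + 1 and G' = t G - 1; the weights 1 - p and p make the pieces agree at z. *)
Definition stein_sol t := if t <= z then (1 - p) * G1 t else p * G2 t.
Let g := stein_sol.

Let gE2 t : z <= t -> g t = p * G2 t.
Proof.
rewrite /g /stein_sol le_eqVlt => /orP[/eqP <-|]; last by rewrite ltNge => /negbTE ->.
by rewrite lexx /G1 /G2 -/p; ring.
Qed.

Let gE1 t : t <= z -> g t = (1 - p) * G1 t.
Proof. by rewrite /g /stein_sol => ->. Qed.

Let Phi_homo : {homo Phi : x y / x <= y}.
Proof. by apply: (derive_ge0_homo dPhi) => t; exact: ltW. Qed.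

(** The Mills bounds control t G1 from below and t G2 from above. On the remaining range 0 <= t <=
    z, Phi t <= p gives (1 - p) G1 <= (1 - Phi t) G1 = Phi t * G2, which trades one bound for the
    other; z <= t <= 0 is symmetric. *)
Lemma stein_sol_le1 t : `|t * g t| <= 1.
Proof.
have /andP[p0 p1] := Phi01 z; rewrite -/p in p0 p1.
have /andP[q0 q1] := Phi01 t.
have v0 := ltW (phiV_gt0 t); have lo := tG1_ge t; have hi := tG2_le t.
have s0 : 0 <= G1 t by rewrite mulr_ge0.
have s1 : 0 <= G2 t by rewrite mulr_ge0 ?subr_ge0.
have u0 : 0 <= 1 - Phi t by rewrite subr_ge0.
have w0 : 0 <= 1 - p by rewrite subr_ge0.
have E : (1 - Phi t) * G1 t = Phi t * G2 t by rewrite /G1 /G2; ring.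
have [tz|/ltW tz] := leP t z.
  rewrite gE1 // ler_norml; have pt : Phi t <= p by exact: Phi_homo.
  have [t0|/ltW t0] := leP t 0.
    apply/andP; split; nra.
  have : 0 <= (p - Phi t) * (t * G1 t) by rewrite !mulr_ge0 // subr_ge0 .
  have : t * ((1 - Phi t) * G1 t) = Phi t * (t * G2 t) by rewrite E; ring.
  have : 0 <= t * G2 t by rewrite mulr_ge0.
  have : 0 <= t * ((1 - p) * G1 t) by rewrite !mulr_ge0.
  move=> *; apply/andP; split; nra.
rewrite gE2 // ler_norml; have pt : p <= Phi t by exact: Phi_homo.
have [t0|/ltW t0] := leP 0 t.
  have : 0 <= t * G2 t by rewrite mulr_ge0.
  move=> *; apply/andP; split; nra.
have : 0 <= (Phi t - p) * (- t * G2 t) by rewrite !mulr_ge0 // ?subr_ge0 ?oppr_ge0.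
have : t * ((1 - Phi t) * G1 t) = Phi t * (t * G2 t) by rewrite E; ring.
have : 0 <= - t * G1 t by rewrite mulr_ge0 ?oppr_ge0.
have : 0 <= - t * (p * G2 t) by rewrite !mulr_ge0 // oppr_ge0.
move=> *; apply/andP; split; nra.
Qed.

Let mono1 (a b : R) : a <= b -> b <= z -> a * g a <= b * g b.
Proof.
move=> ab bz; rewrite !gE1 //; last exact: le_trans bz.
have /andP[_ p1] := Phi01 z; have := tG1_homo ab; rewrite -/p in p1 *; nra.
Qed.

Let mono2 (a b : R) : a <= b -> z <= a -> a * g a <= b * g b.
Proof.
move=> ab za; rewrite !gE2 //; last exact: le_trans ab.
have /andP[p0 _] := Phi01 z; have := tG2_homo ab; rewrite -/p in p0 *; nra.
Qed.

Lemma stein_sol_mono (a b : R) : a <= b -> a * g a <= b * g b.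
Proof.
move=> ab; have [bz|/ltW zb] := leP b z; first exact: mono1.
have [za|/ltW az] := leP z a; first exact: mono2.
by apply: le_trans (mono1 az (lexx z)) (mono2 zb (lexx z)).
Qed.

Let incr1 (a b : R) : a <= b -> b <= z ->
  (b - a) * (a * g a + 1 - p) <= g b - g a <= (b - a) * (b * g b + 1 - p).
Proof.
move=> ab bz; have az := le_trans ab bz; rewrite !gE1 //.
have [c /andP[ac cb] E] := mean_value ab dG1.
have /andP[_ p1] := Phi01 z; rewrite -/p in p1.
have : (1 - p) * G1 b - (1 - p) * G1 a = (b - a) * ((1 - p) * (c * G1 c) + 1 - p).
  by rewrite -mulrBr E; ring.
have : (1 - p) * (a * G1 a) <= (1 - p) * (c * G1 c).
  by rewrite ler_wpM2l ?subr_ge0 // tG1_homo.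
have : (1 - p) * (c * G1 c) <= (1 - p) * (b * G1 b).
  by rewrite ler_wpM2l ?subr_ge0 // tG1_homo.
move=> h1 h2 ->; rewrite !ler_wpM2l ?subr_ge0 //; lra.
Qed.

Let incr2 (a b : R) : a <= b -> z <= a ->
  (b - a) * (a * g a - p) <= g b - g a <= (b - a) * (b * g b - p).
Proof.
move=> ab za; have zb := le_trans za ab; rewrite !gE2 //.
have [c /andP[ac cb] E] := mean_value ab dG2.
have /andP[p0 _] := Phi01 z; rewrite -/p in p0.
have : p * G2 b - p * G2 a = (b - a) * (p * (c * G2 c) - p).
  by rewrite -mulrBr E; ring.
have : p * (a * G2 a) <= p * (c * G2 c) by rewrite ler_wpM2l // tG2_homo.
have : p * (c * G2 c) <= p * (b * G2 b) by rewrite ler_wpM2l // tG2_homo.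
move=> h1 h2 ->; rewrite !ler_wpM2l ?subr_ge0 //; lra.
Qed.

(** The mean value theorem is used on each side of z separately, because the derivative jumps there;
    an interval containing z is cut at z and the two estimates are added. *)
Lemma stein_sol_incr (a b : R) : a <= b ->
  (b - a) * (a * g a + (b <= z)%R%:R - p) <= g b - g a <=
  (b - a) * (b * g b + (a <= z)%R%:R - p).
Proof.
move=> ab; have [bz|/ltW zb] := leP b z.
  by rewrite (le_trans ab bz) /=; apply: incr1.
have [az|/ltW za] := leP a z; last by rewrite !addr0; exact: incr2.
have /andP[h1 h2] := incr1 az (lexx z); have /andP[h3 h4] := incr2 zb (lexx z).
have := mono1 az (lexx z); have := mono2 zb (lexx z).
have : 0 <= z - a by rewrite subr_ge0.
have : 0 <= b - z by rewrite subr_ge0.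
rewrite /= addr0; set u := a * g a in h1 *; set v := b * g b in h4 *.
set t := z * g z in h2 h3 *; clearbody u v t.
move=> *; apply/andP; split; nra.
Qed.
End SteinSolution.

(** * The Gaussian distribution function as an instance *)

Section StandardGaussian.
Context d (T : measurableType d) (R : realType) (P : probability T R).
Variable N : {RV P >-> R}.
Hypothesis hN : std_gaussian N.

Definition rcdf (x : R) : R := fine (cdf N x).

Lemma rcdf_EFin x : (rcdf x)%:E = cdf N x.
Proof. by rewrite /rcdf fineK // fin_num_measure. Qed.

Lemma rcdf_ge0_le1 x : 0 <= rcdf x <= 1.
Proof. by rewrite -!lee_fin rcdf_EFin cdf_ge0 cdf_le1. Qed.

Let phi : R -> R := normal_pdf 0 1.
Let phiV (x : R) : R := (normal_peak 1)^-1 * expR (x ^+ 2 / 2).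

Let phiE x : phi x = normal_peak 1 * expR (- x ^+ 2 / 2).
Proof.
by rewrite /phi normal_pdfE ?oner_neq0 // /normal_fun subr0 expr1n.
Qed.

Let phi_gt0 x : 0 < phi x.
Proof. by rewrite phiE mulr_gt0 ?expR_gt0 // normal_peak_gt0 ?oner_neq0. Qed.

Let phiK x : phi x * phiV x = 1.
Proof.
rewrite phiE /phiV mulrACA divff ?mul1r -?expRD ?mulNr ?addNr ?expR0 //.
by rewrite gt_eqF // normal_peak_gt0 ?oner_neq0.
Qed.

Let phiN x : phi (- x) = phi x.
Proof. by rewrite !phiE sqrrN. Qed.

Let dphi (x : R) : is_derive x (1 : R) phi (- x * phi x).
Proof.
have -> : phi = fun x => normal_peak 1 * expR (- x ^+ 2 / 2) by apply/funext => y; rewrite phiE.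
by apply: trigger_derive; rewrite /GRing.scale /=; field.
Qed.

Let dphiV (x : R) : is_derive x (1 : R) phiV (x * phiV x).
Proof.
apply: trigger_derive; rewrite /phiV /GRing.scale /=; set k := (normal_peak 1)^-1.
by set e := expR _; field.
Qed.

Let dPhi (x : R) : is_derive x (1 : R) rcdf (phi x).
Proof.
have -> : rcdf = fun x => (\int[lebesgue_measure]_(t in [set` `]-oo, x]]) phi t)%R.
  by apply/funext => y; rewrite /rcdf /cdf hN.
have [] := @continuous_FTC1 R phi -oo%O x (x + 1).
- by rewrite ltrDl.
- apply: (@integrableS _ _ _ _ setT) => //; exact: integrable_normal_pdf.
- by rewrite ltNyr.
- by apply: continuous_normal_pdf; rewrite oner_neq0.
move=> h1 h2; apply: DeriveDef => //.
by rewrite -derive1E h2.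
Qed.

Let Phi_y (e : R) : 0 < e -> exists M : R, forall x, M <= x -> 1 - rcdf x < e.
Proof.
move=> e0; have l : (fine \o cdf N) x @[x --> +oo%R] --> (1 : R).
  exact: (fine_cvg (cvg_cdfy1 N)).
have [|M [_ MP]] := cvgr_gt _ l (1 - e); first by rewrite ltrBlDr ltrDl.
exists (M + 1) => x Mx; have /= : 1 - e < rcdf x by apply: MP; lra.
lra.
Qed.

Let Phi_Ny (e : R) : 0 < e -> exists M : R, forall x, M <= x -> rcdf (- x) < e.
Proof.
move=> e0; have l : (fine \o cdf N) x @[x --> -oo%R] --> (0 : R).
  exact: (fine_cvg (cvg_cdfNy0 N)).
have [M [_ MP]] := cvgr_lt _ l e e0.
by exists (1 - M) => x Mx; apply: MP; lra.
Qed.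

Lemma stein_equation_sol (z : R) : exists g : R -> R,
  [/\ forall t, `|t * g t| <= 1,
      forall a b : R, a <= b -> a * g a <= b * g b &
      forall a b : R, a <= b ->
        (b - a) * (a * g a + (b <= z)%R%:R - rcdf z) <= g b - g a <=
        (b - a) * (b * g b + (a <= z)%R%:R - rcdf z)].
Proof.
exists (stein_sol phiV rcdf z); split => [t|a b|a b].
- exact: (stein_sol_le1 phi_gt0 phiK dphi phiN dPhi rcdf_ge0_le1 Phi_y Phi_Ny).
- exact: (stein_sol_mono phi_gt0 phiK dphi dphiV phiN dPhi rcdf_ge0_le1 Phi_y Phi_Ny).
- exact: (stein_sol_incr phi_gt0 phiK dphi dphiV phiN dPhi rcdf_ge0_le1 Phi_y Phi_Ny).
Qed.

(** Absorbs the shift of the argument when F is replaced by its truncations; the constant is the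
    maximum of the density. *)
Lemma rcdf_lipschitz (x y : R) : x <= y -> rcdf y <= rcdf x + normal_peak 1 * (y - x).
Proof.
move=> xy; have [c _ E] := mean_value xy dPhi.
rewrite -lerBlDl E ler_wpM2r ?subr_ge0 //.
by apply: normal_pdf_ub; rewrite oner_neq0.
Qed.
End StandardGaussian.

(** * Contractions as limits of finite sums *)

(** Plain sequences rather than tuples, so that arguments are cut and concatenated without casts
    between lengths. *)
Fixpoint box (n r : nat) : seq (seq nat) :=
  if r is r'.+1 then [seq x :: s | x <- iota 0 n, s <- box n r'] else [:: [::]].

Lemma mem_box n r s : (s \in box n r) = (size s == r) && all (fun x => x < n)%N s.
Proof.
elim: r s => [|r IHr] [|x s] //=.
  by apply/negbTE/allpairsP => -[[y t] /= [_ _]].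
apply/allpairsP/idP => [[[y t] /= [+ + [-> ->]]]|/and3P[sr xn sn]].
  by rewrite mem_iota IHr add0n => /= -> /andP[/eqP -> ->]; rewrite eqxx.
by exists (x, s); rewrite mem_iota IHr; split => //=; rewrite -eqSS sr.
Qed.

Lemma box_uniq n r : uniq (box n r).
Proof.
elim: r => [|r IHr] //=; apply: allpairs_uniq => //; first exact: iota_uniq.
by move=> [x s] [y t] _ _ /= [-> ->].
Qed.

Section BoxSums.
Variable R : realType.
Implicit Types (u v : seq nat -> R) (n m r : nat).

Lemma big_box_cat n a b u :
  \sum_(s <- box n (a + b)) u s = \sum_(x <- box n a) \sum_(y <- box n b) u (x ++ y).
Proof.
elim: a u => [|a IHa] u; first by rewrite add0n big_seq1.
rewrite addSn /= !big_allpairs_dep; apply: eq_bigr => x _.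
by rewrite (IHa (fun s => u (x :: s))).
Qed.

Lemma ler_sum_uniq (I : eqType) (L1 L2 : seq I) (u : I -> R) :
  uniq L1 -> uniq L2 -> {subset L1 <= L2} -> (forall s, 0 <= u s) ->
  \sum_(s <- L1) u s <= \sum_(s <- L2) u s.
Proof.
move=> U1 U2 L12 u0; rewrite [leRHS](bigID (mem L1)) /= ler_wpDr //.
  by apply: sumr_ge0.
rewrite -[leRHS]big_filter le_eqVlt; apply/orP; left; apply/eqP; apply: perm_big.
apply: uniq_perm => //; first exact: filter_uniq.
move=> s; rewrite mem_filter; apply/idP/andP => [sL|[]//].
by split=> //; exact: L12.
Qed.

Lemma box_le n m r u : (n <= m)%N -> (forall s, 0 <= u s) ->
  \sum_(s <- box n r) u s <= \sum_(s <- box m r) u s.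
Proof.
move=> nm u0; apply: ler_sum_uniq; rewrite ?box_uniq // => s.
rewrite !mem_box => /andP[-> /=]; apply: sub_all => x /= xn.
exact: leq_trans nm.
Qed.

Lemma box_restrict n m r (Q : pred (seq nat)) u : (n <= m)%N ->
  \sum_(s <- box n r | Q s) u s =
  \sum_(s <- box m r | Q s && all (fun x => x < n)%N s) u s.
Proof.
move=> nm; rewrite -big_filter -[RHS]big_filter; apply: perm_big; apply: uniq_perm;
  rewrite ?filter_uniq ?box_uniq // => s.
rewrite !mem_filter !mem_box; case: (Q s) => //=; rewrite andbCA; congr (_ && _).
apply/idP/andP => [sn|[]//]; split=> //.
by apply: sub_all sn => x /= xn; exact: leq_trans nm.
Qed.

Lemma seq_le_esum r (L : seq (seq nat)) u : uniq L -> all (fun s => size s == r) L ->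
  (forall s, 0 <= u s) ->
  ((\sum_(s <- L) u s)%:E <= \esum_(t in [set: r.-tuple nat]) (u t)%:E)%E.
Proof.
move=> UL Lr u0; pose L' : seq (r.-tuple nat) := pmap insub L.
have L'E : map val L' = L.
  rewrite (pmap_filter (@insubK _ _ _)); apply/all_filterP.
  by apply: sub_all Lr => s /= sr; rewrite insubT.
have UL' : uniq L' by apply: (@map_uniq _ _ val); rewrite L'E.
apply: esum_ge; exists [set` L']; first by split => //; exact: finite_seq.
rewrite -fsbig_seq //.
by rewrite sumEFin -L'E big_map.
Qed.
Lemma box_le_esum n r u : (forall s, 0 <= u s) ->
  ((\sum_(s <- box n r) u s)%:E <= \esum_(t in [set: r.-tuple nat]) (u t)%:E)%E.
Proof.
move=> u0; apply: seq_le_esum => //; first exact: box_uniq.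
by apply/allP => s; rewrite mem_box => /andP[].
Qed.

Lemma esum_le_box r u (M : R) : (forall s, 0 <= u s) ->
  (forall n, \sum_(s <- box n r) u s <= M) ->
  (\esum_(t in [set: r.-tuple nat]) (u t)%:E <= M%:E)%E.
Proof.
move=> u0 uM; apply: ge_ereal_sup => _ [A [finA _] <-].
rewrite fsbig_finite //= sumEFin lee_fin.
pose L := map val (enum_fset (fset_set A)).
have -> : \sum_(t <- fset_set A) u t = \sum_(s <- L) u s by rewrite big_map.
(* One more than the largest entry occurring in A is the side of a box containing A. *)
apply: le_trans (uM (\max_(s <- L) \max_(x <- s) x).+1).
apply: ler_sum_uniq; rewrite ?box_uniq //.
  by rewrite map_inj_uniq ?fset_uniq //; exact: val_inj.
move=> _ /mapP[t tA ->]; rewrite mem_box size_tuple eqxx /=.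
apply/allP => x xt; rewrite ltnS.
have h1 : (x <= \max_(y <- val t) y)%N by exact: (leq_bigmax_seq x xt).
apply: leq_trans h1 _; have tL : val t \in L by apply: map_f.
exact: (@leq_bigmax_seq _ L xpredT (fun s => \max_(y <- s) y)%N _ tL).
Qed.

Lemma box_cvg_esum r u (M : R) : (forall s, 0 <= u s) ->
  (forall n, \sum_(s <- box n r) u s <= M) ->
  \sum_(s <- box n r) u s @[n --> \oo] -->
    fine (\esum_(t in [set: r.-tuple nat]) (u t)%:E).
Proof.
move=> u0 uM; set l := fine _.
have lE : l%:E = \esum_(t in [set: r.-tuple nat]) (u t)%:E.
  rewrite fineK // ge0_fin_numE; last by apply: esum_ge0 => t _; rewrite lee_fin.
  exact: le_lt_trans (esum_le_box u0 uM) (ltry _).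
have homo : nondecreasing_seq (fun n => \sum_(s <- box n r) u s).
  by move=> n m nm; exact: box_le.
have cv : cvgn (fun n => \sum_(s <- box n r) u s).
  by apply: nondecreasing_is_cvgn => //; exists M => _ [n _ <-].
suff <- : limn (fun n => \sum_(s <- box n r) u s) = l by [].
apply/eqP; rewrite eq_le; apply/andP; split.
  apply: limr_le => //; near=> n.
  by rewrite -lee_fin lE; exact: box_le_esum.
rewrite -lee_fin lE; apply: esum_le_box => // n.
exact: nondecreasing_cvgn_le.
Unshelve. all: by end_near. Qed.

Lemma box_cvg_rsum r v (M : R) :
  (forall n, \sum_(s <- box n r) `|v s| <= M) ->
  \sum_(s <- box n r | uniq s) v s @[n --> \oo] -->
    rsum (Delta r) (fun t : r.-tuple nat => v t).
Proof.
move=> vM.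
have H w : (forall s, 0 <= w s) -> (forall s, w s <= `|v s|) ->
    \sum_(s <- box n r | uniq s) w s @[n --> \oo] -->
    fine (\esum_(t in Delta r) (w (tval t))%:E).
  move=> w0 wv; rewrite esum_mkcond.
  pose w' s := if uniq s then w s else 0.
  rewrite (@eq_esum _ _ setT _ (fun t : r.-tuple nat => (w' t)%:E)) => [|t _]; last first.
    have -> : (t \in Delta r) = uniq t by apply/idP/idP; rewrite inE.
    by rewrite /w'; case: ifP.
  rewrite (_ : (fun n => _) = (fun n => \sum_(s <- box n r) w' s)).
    have w'0 s : 0 <= w' s by rewrite /w'; case: ifP.
    apply: (box_cvg_esum (M := M) w'0) => n.
    by apply: le_trans (vM n); apply: ler_sum => s _; rewrite /w'; case: ifP.
  by apply/funext => n; rewrite big_mkcond.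
rewrite (_ : (fun n => _) = (fun n => \sum_(s <- box n r | uniq s) Num.max (v s) 0 -
    \sum_(s <- box n r | uniq s) Num.max (- v s) 0)).
  apply: cvgB; apply: (H (fun s => Num.max _ 0)) => s; rewrite ?le_max ?lexx ?orbT //;
    by rewrite ge_max normr_ge0 andbT ?ler_norm // -normrN ler_norm.
apply/funext => n; rewrite -sumrB; apply: eq_bigr => s _.
have [h|/ltW h] := leP 0 (v s); first by rewrite max_r ?oppr_le0 // subr0.
by rewrite max_l ?oppr_ge0 // add0r opprK.
Qed.
End BoxSums.

Lemma l2norm_sqr (R : realType) n (f : n.-tuple nat -> R) :
  (l2norm f ^+ 2 = \esum_(t in [set: n.-tuple nat]) (f t ^+ 2)%:E)%E.
Proof. by rewrite sqr_sqrte // esum_ge0 // => t _; rewrite lee_fin sqr_ge0. Qed.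

Lemma l2norm_ge0 (R : realType) n (f : n.-tuple nat -> R) : (0 <= l2norm f)%E.
Proof. exact: sqrte_ge0. Qed.

Lemma l2norm_le_esum (R : realType) n (f : n.-tuple nat -> R) (m : R) :
  (l2norm f <= m%:E)%E ->
  (\esum_(t in [set: n.-tuple nat]) (f t ^+ 2)%:E <= (m ^+ 2)%:E)%E.
Proof.
move=> fm; have m0 := le_trans (l2norm_ge0 f) fm.
by rewrite -l2norm_sqr EFin_expe lee_sqr ?l2norm_ge0.
Qed.

Lemma cvg_sum_seq (R : realType) (I : eqType) (r : seq I) (Q : pred I)
    (u : I -> nat -> R) (l : I -> R) :
  (forall i, i \in r -> Q i -> u i n @[n --> \oo] --> l i) ->
  \sum_(i <- r | Q i) u i n @[n --> \oo] --> \sum_(i <- r | Q i) l i.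
Proof.
move=> ul; rewrite big_seq_cond; under eq_fun do rewrite big_seq_cond.
apply: cvg_big => [|i /andP[]]; [exact: add_continuous|exact: ul].
Qed.

(** * Contractions of a fixed kernel and their truncations *)

Section Kernel.
Variables (R : realType) (q : nat) (f : q.-tuple nat -> R).
Hypothesis hf : l2_0_sym f.
Implicit Types (s a A B : seq nat) (n m l : nat).

Let fv := seq_eval f.

Lemma seq_eval_perm s1 s2 : perm_eq s1 s2 -> size s2 = q -> fv s1 = fv s2.
Proof.
move=> p12 /eqP s2q; have [_ fsym _] := hf.
have /tuple_permP[p ->] : perm_eq s1 (Tuple s2q) by [].
by rewrite /fv seq_eval_tuple fsym -seq_eval_tuple.
Qed.

Lemma seq_eval_nuniq s : size s = q -> ~~ uniq s -> fv s = 0.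
Proof.
move=> /eqP sq nU; have [_ _ f0] := hf.
have -> : s = Tuple sq by [].
by rewrite /fv seq_eval_tuple; apply: f0; exact/negP.
Qed.

Definition nrm2 : R := fine (\esum_(t in [set: q.-tuple nat]) (f t ^+ 2)%:E).

Lemma nrm2_EFin : (nrm2%:E = l2norm f ^+ 2)%E.
Proof.
have [lf _ _] := hf; rewrite l2norm_sqr fineK // -l2norm_sqr.
rewrite ge0_fin_numE ?sqre_ge0 //.
by move: lf; have := l2norm_ge0 f; case: (l2norm f) => [r| |] //= _ _; rewrite -EFinM ltry.
Qed.

Let fv_esum : (\esum_(t in [set: q.-tuple nat]) (fv t ^+ 2)%:E = nrm2%:E)%E.
Proof.
by rewrite nrm2_EFin l2norm_sqr; apply: eq_esum => t _; rewrite /fv seq_eval_tuple.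
Qed.

Lemma box_nrm2 n : \sum_(s <- box n q) fv s ^+ 2 <= nrm2.
Proof.
by rewrite -lee_fin -fv_esum; apply: (@box_le_esum R n q (fun s => fv s ^+ 2)) => s; exact: sqr_ge0.
Qed.

Lemma box_cvg_nrm2 : \sum_(s <- box n q) fv s ^+ 2 @[n --> \oo] --> nrm2.
Proof.
have := box_cvg_esum (fun s => sqr_ge0 (fv s)) box_nrm2.
by rewrite fv_esum.
Qed.

Lemma box_section n l A : (size A + l = q)%N ->
  \sum_(a <- box n l) fv (A ++ a) ^+ 2 <= nrm2.
Proof.
move=> Al; rewrite -(big_map (cat A) xpredT (fun s => fv s ^+ 2)) -lee_fin -fv_esum.
apply: seq_le_esum => [||s]; last exact: sqr_ge0.
  by rewrite map_inj_uniq ?box_uniq // => x y /eqP; rewrite eqseq_cat // eqxx => /eqP.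
apply/allP => _ /mapP[a + ->]; rewrite mem_box size_cat => /andP[/eqP -> _].
by rewrite Al.
Qed.

(** One function covers every f *_r^l f: only the number l of summed indices and the two lists of
    free arguments matter, and r just says that [A] and [B] share a block of length r - l. *)
Definition contraction l A B : R :=
  rsum (Delta l) (fun a : l.-tuple nat => fv (A ++ a) * fv (B ++ a)).

Lemma star_contrE r l (t : (q + q - r - l).-tuple nat) :
  star_contr f f r l t =
  contraction l (take (q - r) t ++ take (r - l) (drop (q - r) t))
                (drop (q - l) t ++ take (r - l) (drop (q - r) t)).
Proof.
by rewrite /star_contr /contraction; congr rsum; apply/funext => a; rewrite !catA.
Qed.

Lemma contraction_cvg l A B : (size A + l = q)%N -> (size B + l = q)%N ->
  \sum_(a <- box n l | uniq a) fv (A ++ a) * fv (B ++ a) @[n --> \oo] -->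
  contraction l A B.
Proof.
move=> Al Bl.
apply: (@box_cvg_rsum R l (fun a => fv (A ++ a) * fv (B ++ a)) (nrm2 + nrm2)) => n.
apply: le_trans (lerD (box_section n Al) (box_section n Bl)).
rewrite -big_split; apply: ler_sum => a _ /=; rewrite normrM.
rewrite -(real_normK (num_real (fv (A ++ a)))) -(real_normK (num_real (fv (B ++ a)))).
set x := `|_|; set y := `|_|; have := sqr_ge0 (x - y).
have : 0 <= x ^+ 2 by exact: sqr_ge0.
have : 0 <= y ^+ 2 by exact: sqr_ge0.
nra.
Qed.

Lemma box_contraction_le n l A : (size A + l = q)%N ->
  \sum_(a <- box n l) fv (A ++ a) ^+ 2 <= contraction l A A.
Proof.
move=> Al; have cv := contraction_cvg Al Al.
apply: (cvgr_to_ge cv); exists n => // m /= nm.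
apply: le_trans (box_le _ nm _) _ => [s|]; first exact: sqr_ge0.
rewrite [leRHS]big_mkcond !big_seq; apply: ler_sum => a.
rewrite mem_box => /andP[/eqP sa _]; case: ifPn => [_|nU]; first by rewrite expr2.
rewrite seq_eval_nuniq ?expr0n //; first by rewrite size_cat sa.
by apply: contra nU; rewrite cat_uniq => /and3P[].
Qed.

Definition tail_mass n : R := nrm2 - \sum_(s <- box n q) fv s ^+ 2.

Lemma tail_mass_ge0 n : 0 <= tail_mass n.
Proof. by rewrite subr_ge0 box_nrm2. Qed.

Lemma tail_mass_cvg : tail_mass n @[n --> \oo] --> (0 : R).
Proof.
rewrite -(subrr nrm2); apply: cvgB box_cvg_nrm2; exact: cvg_cst.
Qed.

(** Each A ++ a occurring here lies in the box of side m but outside that of side n, so its mass is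
    part of the tail. *)
Let box_outer k n l : (k + l = q)%N -> forall m, (n <= m)%N ->
  \sum_(A <- box n k) \sum_(a <- box m l | ~~ all (fun x => x < n)%N a)
     fv (A ++ a) ^+ 2 <= tail_mass n.
Proof.
move=> kl m nm; rewrite lerBrDr -{1}kl big_box_cat -big_split /=.
apply: le_trans (box_nrm2 m); rewrite -{1}kl big_box_cat.
rewrite [leLHS](_ : _ = \sum_(A <- box n k) \sum_(a <- box m l) fv (A ++ a) ^+ 2).
  apply: (@box_le R n m k (fun A => \sum_(a <- box m l) fv (A ++ a) ^+ 2)) => // A.
  by apply: sumr_ge0 => a _; exact: sqr_ge0.
apply: eq_bigr => A _; rewrite addrC [RHS](bigID (all (fun x => x < n)%N)) /=; congr (_ + _).
exact: (box_restrict l xpredT _ nm).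
Qed.

Section Truncation.
Variables (k l n : nat).
Hypothesis kl : (k + l = q)%N.

Let S m A B : R := \sum_(a <- box m l | uniq a) fv (A ++ a) * fv (B ++ a).

(* For m >= n the box-m contraction differs from the box-n one by terms whose
   squares sum to at most the squared tail mass; then let m tend to infinity. *)
Lemma trunc_contraction_le :
  \sum_(A <- box n k) \sum_(B <- box n k | uniq (A ++ B)) S n A B ^+ 2 <=
  2 * (\sum_(A <- box n k) \sum_(B <- box n k | uniq (A ++ B)) contraction l A B ^+ 2)
  + 2 * tail_mass n ^+ 2.
Proof.
pose D m A B : R :=
  \sum_(a <- box m l | uniq a && ~~ all (fun x => x < n)%N a) fv (A ++ a) * fv (B ++ a).
pose V m A : R := \sum_(a <- box m l | ~~ all (fun x => x < n)%N a) fv (A ++ a) ^+ 2.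
have V0 m A : 0 <= V m A by apply: sumr_ge0 => a _; exact: sqr_ge0.
have step m : (n <= m)%N ->
  \sum_(A <- box n k) \sum_(B <- box n k | uniq (A ++ B)) S n A B ^+ 2 <=
  2 * (\sum_(A <- box n k) \sum_(B <- box n k | uniq (A ++ B)) S m A B ^+ 2)
  + 2 * tail_mass n ^+ 2.
  move=> nm.
  have DV A B : D m A B ^+ 2 <= V m A * V m B.
    apply: le_trans (sum_CauchySchwarz _ _ _ _) _; apply: ler_pM;
      try by apply: sumr_ge0 => a _; exact: sqr_ge0.
    - rewrite /V big_mkcond [leRHS]big_mkcond; apply: ler_sum => a _.
      by case: (uniq a); case: (all _ _) => //=; exact: sqr_ge0.
    - rewrite /V big_mkcond [leRHS]big_mkcond; apply: ler_sum => a _.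
      by case: (uniq a); case: (all _ _) => //=; exact: sqr_ge0.
  (* Once the constraint uniq (A ++ B) is dropped, the double sum is the square of the sum of the V
     m A, which is at most the tail mass. *)
  have tail2 : \sum_(A <- box n k) \sum_(B <- box n k) V m A * V m B <= tail_mass n ^+ 2.
    under eq_bigr do rewrite -mulr_sumr.
    rewrite -mulr_suml -expr2 ler_sqr ?nnegrE ?tail_mass_ge0 //.
      exact: box_outer.
    by apply: sumr_ge0.
  have : \sum_(A <- box n k) \sum_(B <- box n k | uniq (A ++ B)) S n A B ^+ 2 <=
    \sum_(A <- box n k) (2 * \sum_(B <- box n k | uniq (A ++ B)) S m A B ^+ 2 +
        2 * \sum_(B <- box n k) V m A * V m B).
    apply: ler_sum => A _; rewrite !mulr_sumr [X in _ <= X + _]big_mkcond [leLHS]big_mkcond.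
    rewrite -big_split /=.
    apply: ler_sum => B _; have := DV A B; have := V0 m A; have := V0 m B.
    have -> : S n A B = S m A B - D m A B.
      rewrite /S (box_restrict l uniq _ nm) [X in X - _](bigID (all (fun x => x < n)%N)) /= /D.
      by rewrite addrK.
    case: ifP => _; last by move=> *; rewrite add0r mulr_ge0 // mulr_ge0.
    have := sqr_ge0 (S m A B + D m A B); nra.
  move/le_trans; apply; rewrite big_split /= -!mulr_sumr lerD2l.
  by rewrite ler_wpM2l.
suff cv : 2 * (\sum_(A <- box n k) \sum_(B <- box n k | uniq (A ++ B)) S m A B ^+ 2)
  + 2 * tail_mass n ^+ 2 @[m --> \oo] --> 
  2 * (\sum_(A <- box n k) \sum_(B <- box n k | uniq (A ++ B)) contraction l A B ^+ 2)
  + 2 * tail_mass n ^+ 2.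
  by apply: (cvgr_to_ge cv); exists n => // m; exact: step.
apply: cvgD; last exact: cvg_cst.
apply: cvgM; first exact: cvg_cst.
have sz A : A \in box n k -> (size A + l = q)%N.
  by rewrite mem_box => /andP[/eqP ->].
apply: cvg_sum_seq => A /sz sA _; apply: cvg_sum_seq => B /sz sB _.
by apply: cvgM; exact: contraction_cvg.
Qed.
End Truncation.
End Kernel.

(** * Comparison of the norms of contractions *)

Lemma le_esum_inj (R : realType) (I J : choiceType) (e : I -> J)
    (a : I -> \bar R) (b : J -> \bar R) :
  injective e -> (forall i, a i <= b (e i))%E -> (forall j, 0 <= b j)%E ->
  (\esum_(i in [set: I]) a i <= \esum_(j in [set: J]) b j)%E.
Proof.
move=> e_inj ab b0; apply: (@le_trans _ _ (\esum_(i in [set: I]) b (e i))).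
  exact: le_esum.
rewrite -(@esum_image _ _ _ setT e b); last by move=> x y _ _; exact: e_inj.
rewrite [leRHS](esumID (e @` setT)) // setTI leeDl //.
exact: esum_ge0.
Qed.

Lemma l2norm_le (R : realType) n m (f : n.-tuple nat -> R) (g : m.-tuple nat -> R) :
  (\esum_(t in [set: n.-tuple nat]) (f t ^+ 2)%:E <=
   \esum_(t in [set: m.-tuple nat]) (g t ^+ 2)%:E)%E -> (l2norm f <= l2norm g)%E.
Proof.
by move=> fg; rewrite /l2norm lee_sqrt // esum_ge0 // => t _; rewrite lee_fin sqr_ge0.
Qed.

Lemma l2norm_restrict_Delta (R : realType) n (g : n.-tuple nat -> R) :
  (l2norm (restrict_Delta g) <= l2norm g)%E.
Proof.
apply: l2norm_le; apply: le_esum => t _; rewrite lee_fin /restrict_Delta indicE.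
by case: (t \in Delta n); rewrite ?mulr1 ?mulr0 // expr0n sqr_ge0.
Qed.

Section KernelBounds.
Variables (R : realType) (q : nat) (f : q.-tuple nat -> R).
Hypothesis hf : l2_0_sym f.
Let fv := seq_eval f.

Lemma box_restrict_star_le r n m : (r <= q)%N ->
  (l2norm (restrict_Delta (star_contr f f r r)) <= m%:E)%E ->
  \sum_(A <- box n (q - r)) \sum_(B <- box n (q - r) | uniq (A ++ B))
    contraction f r A B ^+ 2 <= m ^+ 2.
Proof.
move=> rq /l2norm_le_esum; rewrite -lee_fin; apply: le_trans.
pose u s := (if uniq s then contraction f r (take (q - r) s) (drop (q - r) s) else 0) ^+ 2.
have -> : \esum_(t in setT) (restrict_Delta (star_contr f f r r) t ^+ 2)%:E =
    \esum_(t in [set: (q + q - r - r).-tuple nat]) (u t)%:E.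
  apply: eq_esum => t _; rewrite /restrict_Delta star_contrE /u subnn take0 !cats0 indicE.
  have -> : (t \in Delta _) = uniq t by apply/idP/idP; rewrite inE.
  by case: ifP; rewrite ?mulr1 ?mulr0.
have e : (q + q - r - r = (q - r) + (q - r))%N by lia.
have u0 s : 0 <= u s by exact: sqr_ge0.
apply: le_trans (box_le_esum n _ u0).
rewrite lee_fin e big_box_cat le_eqVlt; apply/orP; left; apply/eqP.
rewrite !big_seq; apply: eq_bigr => A; rewrite mem_box => /andP[/eqP sA _].
rewrite big_mkcond; apply: eq_bigr => B _.
by rewrite /u take_size_cat // drop_size_cat //; case: ifP; rewrite ?expr0n.
Qed.

Lemma box_star_pred_le n m : (0 < q)%N ->
  (l2norm (star_contr f f q q.-1) <= m%:E)%E ->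
  \sum_(x <- box n 1) contraction f q.-1 x x ^+ 2 <= m ^+ 2.
Proof.
move=> q0 /l2norm_le_esum; rewrite -lee_fin; apply: le_trans.
pose u s := contraction f q.-1 s s ^+ 2.
have e : (q + q - q - q.-1 = 1)%N by lia.
have -> : \esum_(t in setT) (star_contr f f q q.-1 t ^+ 2)%:E =
    \esum_(t in [set: (q + q - q - q.-1).-tuple nat]) (u t)%:E.
  apply: eq_esum => t _; rewrite star_contrE subnn take0 drop0 /=.
  have -> : (q - q.-1 = size t)%N by rewrite size_tuple; lia.
  by rewrite take_size drop_size.
have u0 s : 0 <= u s by exact: sqr_ge0.
have -> : box n 1 = box n (q + q - q - q.-1) by rewrite e.
exact: (box_le_esum n _ u0).
Qed.

Lemma l2norm_star_pred_le r : (1 < r <= q)%N ->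
  (l2norm (star_contr f f r r.-1) <= l2norm (star_contr f f r.-1 r.-1))%E.
Proof.
move=> /andP[r1 rq]; apply: l2norm_le.
have e : ((q + q - r - r.-1).+1 = q + q - r.-1 - r.-1)%N by lia.
(* The argument (i, j, k), with a single shared index j, is sent to (i, j, k, j): its halves are the
   two lists of free arguments, and the diagonal is the repetition of j. *)
pose j t : (q + q - r.-1 - r.-1).-tuple nat :=
  tcast e [tuple of rcons (t : (q + q - r - r.-1).-tuple nat) (nth 0%N t (q - r))].
apply: (@le_esum_inj _ _ _ j) => [t t' /(congr1 val)|t|t]; last by rewrite lee_fin sqr_ge0.
  by rewrite /j /= !val_tcast /= => /rcons_inj[tt _]; exact: val_inj.
rewrite lee_fin !star_contrE /j val_tcast /= subnn take0 !cats0.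
have st : size t = (q + q - r - r.-1)%N by rewrite size_tuple.
have -> : (r - r.-1 = 1)%N by lia.
have -> : (q - r.-1 = (q - r).+1)%N by lia.
have lt1 : (q - r < size t)%N by rewrite st; lia.
rewrite (drop_nth 0%N lt1) /= take0.
rewrite -cats1 takel_cat // (take_nth 0%N lt1) -cats1.
rewrite drop_cat; case: ltnP => // h.
have -> : (q - r).+1 = size t by apply/eqP; rewrite eqn_leq h lt1.
by rewrite subnn drop_size.
Qed.

(** For a fixed shared index x the squares f(x, A)^2 f(x, B)^2 sum over A and B to (sum_A f(x,
    A)^2)^2, the square of [f *_q^(q-1) f] at x. *)
Lemma l2norm_star_1_0_le : (0 < q)%N ->
  (l2norm (star_contr f f 1 0) <= l2norm (star_contr f f q q.-1))%E.
Proof.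
move=> q0; case Em : (l2norm (star_contr f f q q.-1)) => [m| |]; last 2 first.
- exact: leey.
- by have := l2norm_ge0 (star_contr f f q q.-1); rewrite Em.
have m0 : 0 <= m by rewrite -lee_fin -Em l2norm_ge0.
have hm n := @box_star_pred_le n m q0 ltac:(by rewrite Em).
have c0 A B : size A = q -> size B = q -> contraction f 0 A B = fv A * fv B.
  move=> sA sB; have := contraction_cvg hf (l := 0) (A := A) (B := B).
  rewrite !addn0 => /(_ sA sB) /cvg_lim <- //.
  under eq_fun do rewrite big_mkcond big_seq1 /= !cats0.
  by rewrite lim_cst.
pose u s := contraction f 0 (take (q - 1) s ++ take 1 (drop (q - 1) s))
                (drop q s ++ take 1 (drop (q - 1) s)) ^+ 2.
rewrite /l2norm -[m]ger0_norm // -sqrtr_sqr -/(sqrte _).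
change (sqrte (\esum_(t in [set: (q + q - 1 - 0).-tuple nat]) (star_contr f f 1 0 t ^+ 2)%:E)
  <= sqrte (m ^+ 2)%:E)%E.
rewrite lee_sqrt ?lee_fin ?sqr_ge0 //.
have -> : \esum_(t in setT) (star_contr f f 1 0 t ^+ 2)%:E =
    \esum_(t in [set: (q + q - 1 - 0).-tuple nat]) (u t)%:E.
  by apply: eq_esum => t _; rewrite star_contrE (subn0 q).
apply: esum_le_box => [s|n]; first exact: sqr_ge0.
have -> : (q + q - 1 - 0 = q.-1 + (1 + q.-1))%N by lia.
rewrite big_box_cat; apply: le_trans (hm n).
under eq_bigr => A _ do rewrite big_box_cat.
rewrite exchange_big.
rewrite big_seq [leRHS]big_seq; apply: ler_sum => x; rewrite mem_box => /andP[/eqP sx _].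
have E A : A \in box n q.-1 -> forall B, B \in box n q.-1 ->
    u (A ++ (x ++ B)) = fv (x ++ A) ^+ 2 * fv (x ++ B) ^+ 2.
  rewrite mem_box => /andP[/eqP sA _] B; rewrite mem_box => /andP[/eqP sB _].
  have sAx : size (A ++ x) = q by rewrite size_cat sA sx; lia.
  have sBx : size (B ++ x) = q by rewrite size_cat sB sx; lia.
  have q1 : (q - 1 = size A)%N by rewrite sA; lia.
  rewrite /u q1 take_size_cat // drop_size_cat // -sx take_size_cat //.
  rewrite catA drop_size_cat // c0 // exprMn.
  have pC (s1 s2 : seq nat) : perm_eq (s1 ++ s2) (s2 ++ s1) by rewrite perm_catC.
  rewrite /fv (seq_eval_perm hf (pC A x)); last by rewrite size_cat addnC -size_cat.
  by rewrite (seq_eval_perm hf (pC B x)) // size_cat addnC -size_cat.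
have -> : \sum_(A <- box n q.-1) \sum_(B <- box n q.-1) u (A ++ (x ++ B)) =
    (\sum_(A <- box n q.-1) fv (x ++ A) ^+ 2) ^+ 2.
  rewrite expr2 mulr_suml !big_seq; apply: eq_bigr => A hA.
  rewrite mulr_sumr !big_seq; apply: eq_bigr => B hB; exact: E.
have c1 : (size x + q.-1 = q)%N by rewrite sx; lia.
have hc := box_contraction_le hf n c1.
rewrite ler_sqr ?nnegrE //; first by apply: sumr_ge0 => A _; exact: sqr_ge0.
by apply: le_trans hc; apply: sumr_ge0 => A _; exact: sqr_ge0.
Qed.
End KernelBounds.

Local Close Scope classical_set_scope.

(** * Truncated kernels on the cube *)

Definition vals n (I : {set 'I_n}) : seq nat := map val (enum I).

Section Vals.
Variable n : nat.
Implicit Types (I J : {set 'I_n}).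

Lemma size_vals I : size (vals I) = #|I|.
Proof. by rewrite size_map -cardE. Qed.

Lemma vals_uniq I : uniq (vals I).
Proof. by rewrite map_inj_uniq ?enum_uniq //; exact: val_inj. Qed.

Lemma mem_vals I (i : 'I_n) : (val i \in vals I) = (i \in I).
Proof. by rewrite mem_map ?mem_enum //; exact: val_inj. Qed.

Lemma vals_lt I : all (fun x => x < n)%N (vals I).
Proof. by apply/allP => _ /mapP[i _ ->]; exact: ltn_ord. Qed.

Lemma vals_box I : vals I \in box n #|I|.
Proof. by rewrite mem_box size_vals eqxx vals_lt. Qed.

Lemma vals_inj : injective (@vals n).
Proof. by move=> I J IJ; apply/setP => i; rewrite -!mem_vals IJ. Qed.

Lemma perm_valsP s I : all (fun x => x < n)%N s -> uniq s ->
  (forall i : 'I_n, (val i \in s) = (i \in I)) -> perm_eq s (vals I).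
Proof.
move=> sn us sI; apply: uniq_perm; rewrite ?vals_uniq // => x.
apply/idP/idP => [xs|/mapP[i]]; last by rewrite mem_enum -sI => iI ->.
have xn := allP sn _ xs.
by rewrite -[x]/(val (Ordinal xn)) mem_vals -sI.
Qed.

Lemma vals_setU I J : [disjoint I & J] -> perm_eq (vals I ++ vals J) (vals (I :|: J)).
Proof.
move=> IJ; apply: perm_valsP; first by rewrite all_cat !vals_lt.
  rewrite cat_uniq !vals_uniq andbT /=; apply/hasPn => _ /mapP[i iJ ->].
  rewrite mem_enum in iJ; rewrite mem_vals; apply/negP => iI.
  by move/pred0P: IJ => /(_ i); rewrite /= iI iJ.
by move=> i; rewrite mem_cat !mem_vals inE.
Qed.

Lemma uniq_vals_cat I J : uniq (vals I ++ vals J) = [disjoint I & J].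
Proof.
apply/idP/idP => [|/vals_setU/perm_uniq->]; last exact: vals_uniq.
rewrite cat_uniq => /and3P[_ /hasPn h _]; apply/pred0P => i /=.
apply/negP => /andP[iI iJ]; have := h (val i); rewrite -/(vals _) mem_vals => /(_ iJ).
by rewrite /= mem_vals iI.
Qed.

(** The repetition-free lists with a given set of entries are its r! orderings; this translates sums
    over tuples into sums over sets. *)
Lemma big_uniq_box (R : realType) r (F : seq nat -> R) :
  (forall s1 s2, perm_eq s1 s2 -> size s2 = r -> F s1 = F s2) ->
  \sum_(s <- box n r | uniq s) F s =
  r`!%:R * \sum_(I : {set 'I_n} | #|I| == r) F (vals I).
Proof.
move=> Fperm; pose so (s : seq nat) := [set i : 'I_n | val i \in s].
rewrite big_seq_cond (partition_big so (fun I => #|I| == r)) /=; last first.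
  move=> s /andP[]; rewrite mem_box => /andP[/eqP <- sn] us.
  rewrite -size_vals; apply/eqP/perm_size; rewrite perm_sym.
  by apply: perm_valsP => // i; rewrite inE.
rewrite mulr_sumr; apply: eq_bigr => I /eqP Ir.
transitivity (\sum_(s <- permutations (vals I)) F s).
  rewrite -big_filter; apply: perm_big; apply: uniq_perm.
  - by rewrite filter_uniq // box_uniq.
  - exact: permutations_uniq.
  move=> s; rewrite mem_filter mem_permutations.
  apply/idP/idP => [/andP[/andP[/andP[]]]|sI].
    rewrite mem_box => /andP[_ sn] us /eqP soI _.
    by apply: perm_valsP => // i; rewrite -soI inE.
  have sb : s \in box n r.
    by rewrite mem_box (perm_size sI) size_vals Ir eqxx (perm_all _ sI) vals_lt.
  rewrite sb (perm_uniq sI) vals_uniq !andbT /=; apply/eqP/setP => i.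
  by rewrite inE (perm_mem sI) mem_vals.
rewrite (eq_big_seq (fun=> F (vals I))) => [|s].
  by rewrite big_const_seq count_predT iter_addr addr0 size_permutations ?vals_uniq //
    size_vals Ir mulr_natl.
by rewrite mem_permutations => sI; apply: Fperm; rewrite ?size_vals.
Qed.
End Vals.

Section KernelOnCube.
Variables (R : realType) (q : nat) (f : q.-tuple nat -> R) (n : nat).
Hypothesis hf : l2_0_sym f.
Let fv := seq_eval f.
Implicit Types (A B I S : {set 'I_n}).

(** J_q sums over increasing tuples with the factor q!, so this is the coefficient of the character
    of S in the truncated integral. *)
Definition coef S : R := if #|S| == q then q`!%:R * fv (vals S) else 0.

Lemma coef_homogeneous : homogeneous q coef.
Proof. by move=> S; rewrite /coef; case: ifP => [/eqP //|_]; rewrite eqxx. Qed.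

Lemma coef_setU A I : [disjoint A & I] -> (#|A| + #|I| = q)%N ->
  coef (A :|: I) = q`!%:R * fv (vals A ++ vals I).
Proof.
move=> AI cq; have h := vals_setU AI.
have sz : #|A :|: I| = q by rewrite -size_vals -(perm_size h) size_cat !size_vals.
rewrite /coef sz eqxx; congr (_ * _).
by apply/esym/(seq_eval_perm hf h); rewrite size_vals.
Qed.

Lemma sum_coef_sqr : \sum_S coef S ^+ 2 = q`!%:R * \sum_(s <- box n q) fv s ^+ 2.
Proof.
have -> : \sum_(s <- box n q) fv s ^+ 2 = \sum_(s <- box n q | uniq s) fv s ^+ 2.
  rewrite [RHS]big_mkcond !big_seq; apply: eq_bigr => s; rewrite mem_box => /andP[/eqP sq _].
  by case: ifPn => // nU; rewrite /fv seq_eval_nuniq // expr0n.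
rewrite (@big_uniq_box n R q (fun s => fv s ^+ 2)); last first.
  by move=> s1 s2 p12 s2q; rewrite /fv (seq_eval_perm hf p12).
rewrite mulrA -expr2 mulr_sumr [RHS]big_mkcond; apply: eq_bigr => S _.
by rewrite /coef; case: ifP; rewrite ?exprMn // expr0n.
Qed.

Let trunc r (A B : seq nat) : R :=
  \sum_(a <- box n r | uniq a) fv (A ++ a) * fv (B ++ a).

(** A block meeting A or B contributes 0 because [f] vanishes outside [Delta], which matches the
    disjointness in [contr]; r! counts the orderings of a block and each coefficient brings one
    q!. *)
Lemma contr_coef r A B : #|A| = (q - r)%N -> #|B| = (q - r)%N -> (r <= q)%N ->
  r`!%:R * contr coef r A B = q`!%:R ^+ 2 * trunc r (vals A) (vals B).
Proof.
move=> cA cB rq; rewrite /trunc.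
rewrite (@big_uniq_box n R r (fun a => fv (vals A ++ a) * fv (vals B ++ a))); last first.
  move=> s1 s2 p12 s2r; rewrite /fv.
  have e (C : {set 'I_n}) : #|C| = (q - r)%N ->
      seq_eval f (vals C ++ s1) = seq_eval f (vals C ++ s2).
    move=> cC; apply: (seq_eval_perm hf); first by rewrite perm_cat2l.
    by rewrite size_cat size_vals cC s2r subnK.
  by rewrite !e.
rewrite mulrCA; congr (_ * _); rewrite mulr_sumr /contr big_mkcondr.
apply: eq_bigr => I /eqP Ir.
have cAI : (#|A| + #|I| = q)%N by rewrite cA Ir subnK.
have cBI : (#|B| + #|I| = q)%N by rewrite cB Ir subnK.
have z (C : {set 'I_n}) : (#|C| + #|I| = q)%N -> ~~ [disjoint C & I] -> fv (vals C ++ vals I) = 0.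
  move=> cC nd; apply: (seq_eval_nuniq hf); first by rewrite size_cat !size_vals.
  by rewrite uniq_vals_cat.
rewrite -finset.setI_eq0 finset.setIUr finset.setU_eq0 ![I :&: _]finset.setIC !finset.setI_eq0.
case: ifPn => [/andP[dA dB]|].
  by rewrite !coef_setU //; ring.
rewrite negb_and => /orP[/(z _ cAI)|/(z _ cBI)] ->; by rewrite ?mul0r ?mulr0.
Qed.

(** The factor r! >= 1 in [contr_coef] is discarded, and sets are read as increasing lists, so the
    sum is part of a nonnegative sum over boxes, to which [trunc_contraction_le] applies. *)
Lemma contr_coef_le m r : (0 < r < q)%N ->
  (l2norm (restrict_Delta (star_contr f f r r)) <= m%:E)%E ->
  \sum_(p : {set 'I_n} * {set 'I_n} |
     [&& [disjoint p.1 & p.2], #|p.1| == q - r & #|p.2| == q - r]%N)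
     contr coef r p.1 p.2 ^+ 2 <=
  q`!%:R ^+ 4 * (2 * m ^+ 2 + 2 * tail_mass f n ^+ 2).
Proof.
move=> /andP[r0 rq] hm; have rq' := ltnW rq.
have Q0 : 0 <= q`!%:R ^+ 4 :> R by rewrite exprn_ge0.
pose L := [seq (x, y) | x <- box n (q - r), y <- box n (q - r)].
pose L2 := [seq xy <- L | uniq (xy.1 ++ xy.2)].
pose L1 := [seq (vals p.1, vals p.2) | p : {set 'I_n} * {set 'I_n} <-
   [seq p : {set 'I_n} * {set 'I_n} <- index_enum ({set 'I_n} * {set 'I_n})%type |
     [&& [disjoint p.1 & p.2], #|p.1| == q - r & #|p.2| == q - r]%N]].
apply: (@le_trans _ _ (q`!%:R ^+ 4 * \sum_(xy <- L1) trunc r xy.1 xy.2 ^+ 2)).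
  rewrite big_map big_filter mulr_sumr; apply: ler_sum => -[A B] /= /and3P[_ /eqP cA /eqP cB].
  have -> : q`!%:R ^+ 4 * trunc r (vals A) (vals B) ^+ 2 =
    (q`!%:R ^+ 2 * trunc r (vals A) (vals B)) ^+ 2 by ring.
  rewrite -contr_coef // exprMn ler_peMl ?sqr_ge0 // exprn_ege1 // ler1n; exact: fact_gt0.
rewrite ler_wpM2l //; apply: (@le_trans _ _ (\sum_(xy <- L2) trunc r xy.1 xy.2 ^+ 2)).
  apply: ler_sum_uniq => [||_ /mapP[[A B] + ->]|xy]; last exact: sqr_ge0.
  - rewrite map_inj_uniq ?filter_uniq ?index_enum_uniq //.
    by move=> [A B] [A' B'] /= [/vals_inj -> /vals_inj ->].
  - rewrite filter_uniq // allpairs_uniq ?box_uniq //.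
    by move=> [x y] [x' y'] _ _ /= [-> ->].
  rewrite !mem_filter /= => /andP[/and3P[dAB /eqP cA /eqP cB] _].
  rewrite /= uniq_vals_cat dAB /=; apply/allpairsP; exists (vals A, vals B).
  by rewrite -{1}cA -cB !vals_box.
have -> : \sum_(xy <- L2) trunc r xy.1 xy.2 ^+ 2 =
    \sum_(A <- box n (q - r)) \sum_(B <- box n (q - r) | uniq (A ++ B)) trunc r A B ^+ 2.
  rewrite big_filter big_mkcond /L big_allpairs_dep /=.
  by apply: eq_bigr => A _; rewrite -big_mkcond.
apply: le_trans (trunc_contraction_le hf n (subnK rq')) _; rewrite lerD2r ler_wpM2l //.
exact: box_restrict_star_le.
Qed.

(** The influence of i is at most q!^2 times [f *_q^(q-1) f] at i: the sets containing i correspond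
    to some of the lists a completing i to a tuple, and all terms are squares. *)
Lemma influence_coef_le m : (0 < q)%N ->
  (l2norm (star_contr f f q q.-1) <= m%:E)%E ->
  \sum_(i < n) (\sum_(S : {set 'I_n} | i \in S) coef S ^+ 2) ^+ 2 <=
  q`!%:R ^+ 4 * m ^+ 2.
Proof.
move=> q0 hm.
have Q0 : 0 <= q`!%:R ^+ 4 :> R by rewrite exprn_ge0.
apply: le_trans (_ : q`!%:R ^+ 4 * \sum_(i < n) contraction f q.-1 [:: val i] [:: val i] ^+ 2 <= _);
  last first.
  rewrite ler_wpM2l //; apply: le_trans (box_star_pred_le n q0 hm).
  rewrite (_ : box n 1 = [seq x :: s | x <- iota 0 n, s <- box n 0]) // big_allpairs_dep.
  rewrite -[X in iota _ X]subn0 -/(index_iota 0 n) big_mkord.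
  by apply: ler_sum => i _; rewrite big_seq1.
rewrite mulr_sumr; apply: ler_sum => i _.
have c1 : (size [:: val i] + q.-1 = q)%N by rewrite /= add1n prednK.
have c0 : 0 <= contraction f q.-1 [:: val i] [:: val i].
  by apply: le_trans (box_contraction_le hf n c1); apply: sumr_ge0 => a _; exact: sqr_ge0.
have -> : q`!%:R ^+ 4 * contraction f q.-1 [:: val i] [:: val i] ^+ 2 =
   (q`!%:R ^+ 2 * contraction f q.-1 [:: val i] [:: val i]) ^+ 2 by ring.
rewrite ler_sqr ?nnegrE ?mulr_ge0 ?sqr_ge0 //; last by apply: sumr_ge0 => S _; exact: sqr_ge0.
apply: (@le_trans _ _ (q`!%:R ^+ 2 * \sum_(a <- box n q.-1) fv ([:: val i] ++ a) ^+ 2)); last first.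
  by rewrite ler_wpM2l ?sqr_ge0 //; exact: box_contraction_le.
pose L := [seq vals (U :\ i) | U : {set 'I_n} <-
   [seq U : {set 'I_n} <- index_enum {set 'I_n} | (i \in U) && (#|U| == q)]].
apply: (@le_trans _ _ (q`!%:R ^+ 2 * \sum_(a <- L) fv ([:: val i] ++ a) ^+ 2)); last first.
  rewrite ler_wpM2l ?sqr_ge0 //; apply: ler_sum_uniq => [||_ /mapP[U + ->]|s]; last exact: sqr_ge0.
  - rewrite map_inj_in_uniq ?filter_uniq ?index_enum_uniq // => S T.
    rewrite !mem_filter => /andP[/andP[iS _] _] /andP[/andP[iT _] _] /vals_inj ST.
    by rewrite -(finset.setD1K iS) -(finset.setD1K iT) ST.
  - exact: box_uniq.
  rewrite mem_filter => /andP[/andP[iS /eqP cS] _].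
  have <- : #|U :\ i| = q.-1 by move: cS; rewrite (cardsD1 i) iS => <-.
  exact: vals_box.
rewrite big_map big_filter mulr_sumr big_mkcondr; apply: ler_sum => S iS.
case: ifPn => cS; last by rewrite /coef (negbTE cS) expr0n.
have d : [disjoint [set i] & S :\ i] by rewrite disjoints1 !inE eqxx.
have := coef_setU d; rewrite finset.setD1K // cards1 => ->.
  by rewrite exprMn /vals enum_set1.
by have := cardsD1 i S; rewrite iS (eqP cS) => <-.
Qed.

Section Distance.
Variables (g : R -> R) (z p m : R).
Hypotheses (p01 : 0 <= p <= 1) (tg_le1 : forall t, `|t * g t| <= 1).
Hypothesis tg_mono : forall a b : R, a <= b -> a * g a <= b * g b.
Hypothesis g_incr : forall a b : R, a <= b ->
  (b - a) * (a * g a + (b <= z)%R%:R - p) <= g b - g a <=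
  (b - a) * (b * g b + (a <= z)%R%:R - p).
Hypotheses (q0 : (0 < q)%N) (m0 : 0 <= m).
Hypothesis m_restr : forall r, (0 < r < q)%N ->
  (l2norm (restrict_Delta (star_contr f f r r)) <= m%:E)%E.
Hypothesis m_pred : (l2norm (star_contr f f q q.-1) <= m%:E)%E.

(** [kolmogorov_cube] with s = 2 q q!^2 (m + tail) and t = q!^2 m; s^2 covers the q - 1 <= q^2
    values of r and 2 m^2 + 2 tail^2 <= 4 (m + tail)^2. *)
Lemma kolmogorov_truncation :
  `|Ex (fun w => (walsh coef w <= z)%R%:R) - p| <=
  2 * `|1 - q`!%:R * \sum_(s <- box n q) fv s ^+ 2| +
  2 ^+ q.+1 * (2 * q%:R * q`!%:R ^+ 2 * (m + tail_mass f n)) +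
  4 * 3 ^+ q * (1 + 4 * q%:R) * (q`!%:R ^+ 2 * m).
Proof.
have tm0 := tail_mass_ge0 hf n.
have Q1 : 1 <= q%:R :> R by rewrite ler1n.
rewrite -sum_coef_sqr; apply: (kolmogorov_cube coef_homogeneous p01 tg_le1 tg_mono g_incr) => //.
- by apply: mulr_ge0; [rewrite !mulr_ge0 ?sqr_ge0|exact: addr_ge0].
- by apply: mulr_ge0 => //; exact: sqr_ge0.
- apply: (@le_trans _ _ (\sum_(1 <= r < q) q`!%:R ^+ 4 * (2 * m ^+ 2 + 2 * tail_mass f n ^+ 2))).
    rewrite !big_nat; apply: ler_sum => r rq; exact: contr_coef_le (m_restr rq).
  rewrite sumr_const_nat -[_ *+ (q - 1)]mulr_natl.
  have -> : (2 * q%:R * q`!%:R ^+ 2 * (m + tail_mass f n)) ^+ 2 =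
    q`!%:R ^+ 4 * (4 * q%:R ^+ 2 * (m + tail_mass f n) ^+ 2) by ring.
  rewrite mulrCA ler_wpM2l ?exprn_ge0 //.
  have h1 : (q - 1)%N%:R <= q%:R ^+ 2 :> R.
    by apply: (@le_trans _ _ q%:R); [rewrite ler_nat leq_subr|rewrite expr2 ler_peMl].
  have h2 : 2 * m ^+ 2 + 2 * tail_mass f n ^+ 2 <= 4 * (m + tail_mass f n) ^+ 2.
    move: tm0; set t := tail_mass f n; clearbody t => t0.
    have := mulr_ge0 m0 t0; have := sqr_ge0 m; have := sqr_ge0 t; lra.
  have -> : 4 * q%:R ^+ 2 * (m + tail_mass f n) ^+ 2 =
     q%:R ^+ 2 * (4 * (m + tail_mass f n) ^+ 2) by ring.
  by apply: ler_pM => //; apply: addr_ge0; apply: mulr_ge0 => //; exact: sqr_ge0.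
have -> : (q`!%:R ^+ 2 * m) ^+ 2 = q`!%:R ^+ 4 * m ^+ 2 by ring.
exact: influence_coef_le.
Qed.
End Distance.
End KernelOnCube.

Local Open Scope classical_set_scope.
Local Open Scope ring_scope.

(** * From the cube to the Rademacher sequence *)

Section RademacherBridge.
Context d (T : measurableType d) (R : realType) (P : probability T R).
Variable X : nat -> {RV P >-> R}.
Hypothesis hX : rademacher_seq X.
Variables (q : nat) (f : q.-tuple nat -> R) (n : nat).
Notation cube := {ffun 'I_n -> bool}.
Implicit Types (v : cube).

Let sgn_inj v v' (i : 'I_n) : sgn R i v = sgn R i v' -> v i = v' i.
Proof.
rewrite /sgn; case: (v i); case: (v' i) => //; rewrite expr0 expr1 => h; exfalso; lra.
Qed.

Lemma mult_integral_trunc_walsh (w : T) v : (forall i : 'I_n, X i w = sgn R i v) ->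
  mult_integral_trunc X f n w = walsh (@coef R q f n) v.
Proof.
move=> Xv; pose G (l : seq 'I_n) := seq_eval f (map val l) * \prod_(i <- l) X i w.
transitivity (q`!%:R * \sum_(t : q.-tuple 'I_n | sorted ltn (map val t)) G t).
  congr (_ * _); apply: eq_bigr => t _; rewrite /G -seq_eval_tuple big_tuple.
  by [].
transitivity (q`!%:R * \sum_(S : {set 'I_n} | #|S| == q) G (enum S)); last first.
  rewrite mulr_sumr big_mkcond; apply: eq_bigr => S _; rewrite /coef.
  case: ifP => _; last by rewrite mul0r.
  rewrite /G -mulrA; congr (_ * (_ * _)); rewrite big_enum.
  by apply: eq_bigr => i _.
congr (_ * _).
rewrite -[LHS]big_filter -[RHS]big_filter.
rewrite -(big_map (fun t : q.-tuple 'I_n => tval t) xpredT G).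
rewrite -(big_map (fun S : {set 'I_n} => enum S) xpredT G).
apply: perm_big; apply: uniq_perm.
- by rewrite map_inj_uniq ?filter_uniq ?index_enum_uniq //; exact: val_inj.
- rewrite map_inj_uniq ?filter_uniq ?index_enum_uniq // => A B AB.
  by apply/setP => i; rewrite -mem_enum AB mem_enum.
have enum_sorted (S : {set 'I_n}) : sorted ltn (map val (enum S)).
  rewrite /enum_mem -enumT; apply: (subseq_sorted ltn_trans _ (iota_ltn_sorted 0 n)).
  rewrite -val_enum_ord; apply: map_subseq; exact: filter_subseq.
move=> l; apply/mapP/mapP => [[t]|[S]]; rewrite mem_filter => /andP[h _] ->.
  have us : uniq t by rewrite -(map_inj_uniq val_inj) (sorted_uniq ltn_trans ltnn).
  exists [set i in t].
    by rewrite mem_filter mem_index_enum cardsE (card_uniqP us) size_tuple eqxx.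
  apply: (inj_map val_inj); apply: (irr_sorted_eq ltn_trans ltnn) => // x.
  apply/mapP/mapP => -[i it ->]; exists i => //; first by rewrite mem_enum inE.
  by move: it; rewrite mem_enum inE.
have sz : size (enum S) == q by rewrite -cardE.
exists (Tuple sz) => //; rewrite mem_filter mem_index_enum andbT; exact: enum_sorted.
Qed.

Definition atom v : set T := [set w | forall i : 'I_n, X i w = sgn R i v].

Let J : {fset nat} := [fset i | i in iota 0 n]%fset.
(** [independent_seq] asks for a set at every index; the default value 1 applies to indices from n
    on, which lie outside [J]. *)
Let side v (i : nat) : set R := [set if insub i is Some j then sgn R (j : 'I_n) v else 1].

Let atomE v : atom v = \bigcap_(i in [set` J]) (X i @^-1` side v i).
Proof.
apply/seteqP; split => w /=.
  move=> wv i /=; rewrite inE /= mem_iota => /= ilt; rewrite /side insubT /=.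
  by have := wv (Ordinal ilt).
move=> wv i; have := wv (val i); rewrite /side /= valK; apply.
by rewrite inE /= mem_iota /= add0n.
Qed.

Lemma measurable_atom v : measurable (atom v).
Proof.
rewrite atomE; apply: fin_bigcap_measurable => // i _.
rewrite -[_ @^-1` _]setTI; apply: measurable_funP => //; exact: measurable_set1.
Qed.

Lemma probability_atom v : P (atom v) = ((2 ^+ n)^-1)%:E.
Proof.
have [hind hhalf] := hX.
rewrite atomE hind; last by move=> i; exact: measurable_set1.
rewrite (eq_bigr (fun=> (2^-1)%:E)) => [|i _]; last first.
  have [h1 h2] := hhalf i; rewrite /side; case: insubP => [j _ _|_]; last exact: h1.
  by rewrite /sgn; case: (v j).
rewrite prodEFin; congr _%:E.
have -> : n = size (enum_fset J).
  by rewrite -[RHS]/(#|` J|) card_fseq undup_id ?iota_uniq ?size_iota.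
by rewrite big_const_seq count_predT iter_mulr mulr1 exprVn.
Qed.

(** A one-sided statement: the atoms miss a null set on which some X i is not a sign, and a lower
    bound avoids treating it. Upper bounds come from complements. *)
Lemma le_probability_cube (Q : pred cube) (E : set T) : measurable E ->
  (forall v, Q v -> atom v `<=` E) -> ((Ex (fun v => (Q v)%:R : R))%:E <= P E)%E.
Proof.
move=> mE QE; pose s := [seq v <- index_enum (cube : finType) | Q v].
have us : uniq s by rewrite filter_uniq ?index_enum_uniq.
apply: (@le_trans _ _ (P (\bigcup_(v in [set` s]) atom v))); last first.
  apply: le_measure; rewrite ?inE //.
    by apply: fin_bigcup_measurable => // v _; exact: measurable_atom.
  by apply: bigcup_sub => v /=; rewrite mem_filter => /andP[Qv _]; exact: QE.
rewrite measure_fin_bigcup //; last 2 first.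
- by move=> v v' _ _ [w [wv wv']]; apply/ffunP => i; apply: sgn_inj; rewrite -wv.
- by move=> v _; exact: measurable_atom.
rewrite -fsbig_seq // (eq_bigr (fun=> ((2 ^+ n)^-1)%:E)) => [|v _]; last first.
  exact: probability_atom.
rewrite sumEFin lee_fin big_filter /Ex mulr_sumr [leRHS]big_mkcond.
by apply: ler_sum => v _; case: (Q v); rewrite ?mulr1 ?mulr0.
Qed.

Lemma measurable_mult_integral_trunc : measurable_fun setT (mult_integral_trunc X f n).
Proof.
apply: measurable_funM => //.
under eq_fun do rewrite big_mkcond.
apply: measurable_sum => t; case: (sorted _ _) => //.
apply: measurable_funM => //; apply: measurable_prod => k _; exact: measurable_funP.
Qed.

End RademacherBridge.

(** * From the truncated integral to F *)

Section Perturbation.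
Context d (T : measurableType d) (R : realType) (P : probability T R).
Variables (X : nat -> {RV P >-> R}) (q : nat) (f : q.-tuple nat -> R) (F : {RV P >-> R}).
Hypothesis hX : rademacher_seq X.
Variable n : nat.
Let J := mult_integral_trunc X f n.
Let mJ : measurable_fun setT J := measurable_mult_integral_trunc X f n.

Definition far (e : R) : set T := [set w | e ^+ 2 <= (F w - J w) ^+ 2].

Let mFJ : measurable_fun setT (fun w => (F w - J w) ^+ 2).
Proof. by apply: measurable_funX; apply: measurable_funB. Qed.

Lemma measurable_far e : measurable (far e).
Proof.
rewrite -[far e]setTI; have := mFJ measurableT (measurable_itv `[e ^+ 2, +oo[).
by congr (measurable (_ `&` _)); apply/seteqP; split => w /=; rewrite in_itv /= andbT.
Qed.

Lemma far_chebyshev e : 0 < e ->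
  ((e ^+ 2)%:E * P (far e) <= 'E_P[fun w => ((F w - J w) ^+ 2)%R])%E.
Proof.
move=> e0; have e20 : 0 < e ^+ 2 by rewrite exprn_gt0.
have := @le_integral_abse _ _ _ P setT measurableT (fun w => ((F w - J w) ^+ 2)%:E) _
  (proj2 (measurable_EFinP _ _) mFJ) e20.
rewrite setTI (_ : [set x | _] = far e); last first.
  apply/seteqP; split => w /=; rewrite /far /= lee_fin ger0_norm ?sqr_ge0 //.
move=> /le_trans; apply; rewrite unlock le_eqVlt; apply/orP; left; apply/eqP.
by apply: eq_integral => w _; rewrite /= ger0_norm ?sqr_ge0.
Qed.

Let atomJ v w : atom X v w -> J w = walsh (@coef R q f n) v.
Proof. by move=> wv; exact: mult_integral_trunc_walsh. Qed.

Let pr (A : set T) : R := fine (P A).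
Let prE A : measurable A -> P A = (pr A)%:E.
Proof. by move=> mA; rewrite /pr fineK // fin_num_measure. Qed.

Let sqr_lt e (a b : R) : 0 < e -> e < a - b -> e ^+ 2 <= (b - a) ^+ 2.
Proof. by move=> e0 eab; rewrite -[(b - a) ^+ 2]sqrrN opprB ler_sqr ?nnegrE; lra. Qed.

Let half (r : R) (b : bool) : measurable [set w | if b then J w <= r else r < J w].
Proof.
rewrite -[X in measurable X]setTI; case: b.
  have := mJ measurableT (measurable_itv `]-oo, r]).
  by congr (measurable (_ `&` _)); apply/seteqP; split => w /=; rewrite in_itv.
have := mJ measurableT (measurable_itv `]r, +oo[).
by congr (measurable (_ `&` _)); apply/seteqP; split => w /=; rewrite in_itv /= andbT.
Qed.

Let mF x : measurable (F @^-1` `]-oo, x]).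
Proof. by rewrite -[_ @^-1` _]setTI; apply: measurable_funP. Qed.

(** The event estimated is J > x + e, because the cube bounds probabilities only from below; off
    [far e] it forces F > x. *)
Lemma cdf_le_cube e x : 0 < e ->
  fine (cdf F x) <= Ex (fun v => (walsh (@coef R q f n) v <= x + e)%R%:R) + pr (far e).
Proof.
move=> e0; pose D := [set w | x + e < J w].
have mD : measurable D := half (x + e) false.
have mA := mF x; set A := F @^-1` _ in mA.
have mS := measurable_far e.
have h1 : ((Ex (fun v => ((x + e < walsh (@coef R q f n) v)%R)%:R))%:E <= P D)%E.
  by apply: (le_probability_cube hX) => // v xv w wv; rewrite /D /= (atomJ wv).
have h2 : (P D <= P (~` A) + P (far e))%E.
  apply: le_trans (measureU2 _ _ _) => //; last exact: measurableC.
  apply: le_measure; rewrite ?inE //; first by apply: measurableU => //; exact: measurableC.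
  move=> w; rewrite /D /= => Jw; have [Fx|Fx] := leP (F w) x; [right|left].
    by apply: sqr_lt => //; lra.
  by rewrite /A /= in_itv /= => /le_lt_trans/(_ Fx); rewrite ltxx.
have := le_trans h1 h2; rewrite probability_setC // !prE // -EFinB -EFinD lee_fin.
have -> : Ex (fun v => ((x + e < walsh (@coef R q f n) v)%R)%:R) =
    1 - Ex (fun v => (walsh (@coef R q f n) v <= x + e)%R%:R) :> R.
  rewrite -[X in X - _](Ex_cst n) -ExB; apply: eq_Ex => v.
  by case: leP; rewrite ?subr0 ?subrr.
by rewrite /cdf /distribution /pushforward -/A -/(pr A); lra.
Qed.

Lemma cube_le_cdf e x : 0 < e ->
  Ex (fun v => (walsh (@coef R q f n) v <= x - e)%R%:R) <= fine (cdf F x) + pr (far e).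
Proof.
move=> e0; pose D := [set w | J w <= x - e].
have mD : measurable D := half (x - e) true.
have mA := mF x; set A := F @^-1` _ in mA.
have mS := measurable_far e.
have h1 : ((Ex (fun v => (walsh (@coef R q f n) v <= x - e)%R%:R))%:E <= P D)%E.
  by apply: (le_probability_cube hX) => // v xv w wv; rewrite /D /= (atomJ wv).
have h2 : (P D <= P A + P (far e))%E.
  apply: le_trans (measureU2 _ _ _) => //.
  apply: le_measure; rewrite ?inE //; first exact: measurableU.
  move=> w; rewrite /D /= => Jw; have [Fx|Fx] := leP (F w) x; [left|right].
    by rewrite /A /= in_itv.
  by rewrite /far /= -[(F w - J w) ^+ 2]sqrrN opprB; apply: sqr_lt => //; lra.
by have := le_trans h1 h2; rewrite !prE.
Qed.

Lemma far_le e (m : R) : 0 < e ->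
  ('E_P[fun w => ((F w - J w) ^+ 2)%R] <= (e ^+ 2 * m)%:E)%E -> pr (far e) <= m.
Proof.
move=> e0 /(le_trans (far_chebyshev e0)).
rewrite (prE (measurable_far e)) -EFinM lee_fin ler_pM2l //; exact: exprn_gt0.
Qed.
End Perturbation.

Section KolmogorovBound.
Context d (T : measurableType d) (R : realType) (P : probability T R).
Context d' (T' : measurableType d') (P' : probability T' R).
Variables (X : nat -> {RV P >-> R}) (q : nat) (f : q.-tuple nat -> R) (F : {RV P >-> R}).
Variable N : {RV P' >-> R}.
Hypotheses (hX : rademacher_seq X) (hf : l2_0_sym f) (hF : is_mult_integral X f F).
Hypotheses (hN : std_gaussian N) (q0 : (0 < q)%N).
Variable m : R.
Hypothesis m0 : 0 <= m.
Hypothesis m_restr : forall r, (0 < r < q)%N ->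
  (l2norm (restrict_Delta (star_contr f f r r)) <= m%:E)%E.
Hypothesis m_pred : (l2norm (star_contr f f q q.-1) <= m%:E)%E.

Let bound (y t : R) : R :=
  2 * `|1 - q`!%:R * y| + 2 ^+ q.+1 * (2 * q%:R * q`!%:R ^+ 2 * (m + t)) +
  4 * 3 ^+ q * (1 + 4 * q%:R) * (q`!%:R ^+ 2 * m).

Let B n := bound (\sum_(s <- box n q) seq_eval f s ^+ 2) (tail_mass f n).

Let B_cvg : B n @[n --> \oo] --> bound (nrm2 f) 0.
Proof.
apply: cvgD; last exact: cvg_cst.
apply: cvgD.
  apply: cvgM; first exact: cvg_cst.
  apply: cvg_norm; apply: cvgB; first exact: cvg_cst.
  by apply: cvgM; [exact: cvg_cst|exact: box_cvg_nrm2].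
apply: cvgM; first exact: cvg_cst.
apply: cvgM; first exact: cvg_cst.
by apply: cvgD; [exact: cvg_cst|exact: tail_mass_cvg].
Qed.

Let cubeB n x : `|Ex (fun v => (walsh (@coef R q f n) v <= x)%R%:R) - rcdf N x| <= B n.
Proof.
have [g [g1 g2 g3]] := stein_equation_sol hN x.
exact: (kolmogorov_truncation n hf (rcdf_ge0_le1 N x) g1 g2 g3).
Qed.

Let K : R := normal_peak 1.
Let K0 : 0 <= K. Proof. exact: normal_peak_ge0. Qed.

Let approx e x : 0 < e ->
  `|fine (cdf F x) - rcdf N x| <= bound (nrm2 f) 0 + (K + 1) * e.
Proof.
move=> e0.
have cv : B n + (K + 1) * e @[n --> \oo] --> bound (nrm2 f) 0 + (K + 1) * e.
  by apply: cvgD B_cvg _; exact: cvg_cst.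
apply: (cvgr_to_ge cv).
(* A mean square error of at most e^3 gives P(far e) <= e by Chebyshev; together with the Lipschitz
   cost K e this is the (K + 1) e. *)
have e3 : 0 < e ^+ 2 * e by rewrite mulr_gt0 // exprn_gt0.
have /fine_cvgP[Efin Ecv] := hF.
have Elt := cvgr_lt _ Ecv _ e3.
near=> n.
have Ele : ('E_P[fun w => ((F w - mult_integral_trunc X f n w) ^+ 2)%R] <= (e ^+ 2 * e)%:E)%E.
  have Efin' : 'E_P[fun w => ((F w - mult_integral_trunc X f n w) ^+ 2)%R]%E \is a fin_num.
    by near: n.
  rewrite -(fineK Efin') lee_fin ltW //; near: n; exact: Elt.
have pe := far_le e0 Ele.
have h1 := cdf_le_cube f F hX n x e0; have h2 := cube_le_cdf f F hX n x e0.
have /ler_normlP[c1 c1'] := cubeB n (x + e).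
have /ler_normlP[c2 c2'] := cubeB n (x - e).
have xe : x <= x + e by lra.
have ex : x - e <= x by lra.
have l1 := rcdf_lipschitz hN xe; have l2 := rcdf_lipschitz hN ex.
rewrite -/K in l1 l2; move: pe h1 h2 c1 c1' c2 c2' l1 l2.
set y := fine (P _); set y1 := Ex _; set y2 := Ex _; set y3 := fine _ => *.
rewrite ler_norml; apply/andP; split; lra.
Unshelve. all: by end_near. Qed.

Lemma cdf_distance_le x : `|1 - q`!%:R * nrm2 f| <= m ->
  `|fine (cdf F x) - rcdf N x| <=
  (2 + 2 ^+ q.+1 * (2 * q%:R * q`!%:R ^+ 2) +
   4 * 3 ^+ q * (1 + 4 * q%:R) * q`!%:R ^+ 2) * m.
Proof.
move=> hm; apply: (@le_trans _ _ (bound (nrm2 f) 0)).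
  apply/ler_addgt0Pr => e e0; have K1 : 0 < K + 1 by rewrite ltr_wpDl.
  have := approx x (divr_gt0 e0 K1).
  by rewrite mulrC divfK // gt_eqF.
rewrite /bound addr0 [leRHS]mulrDl [X in _ <= X + _]mulrDl !mulrA !lerD2r.
by rewrite ler_pM2l.
Qed.
End KolmogorovBound.

Local Open Scope ereal_scope.

Theorem theorem4p2 (R : realType) (q : nat) (hq : (2 <= q)%N) :
  exists C1 C2 : R, (0 < C1)%R /\ (0 < C2)%R /\
  forall (d : measure_display) (T : measurableType d) (P : probability T R)
    (X : nat -> {RV P >-> R}) (f : q.-tuple nat -> R) (F : {RV P >-> R})
    (d' : measure_display) (T' : measurableType d') (P' : probability T' R)
    (N : {RV P' >-> R}),
  rademacher_seq X ->
  l2_0_sym f ->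
  is_mult_integral X f F ->
  (forall r : nat, (1 <= r <= q.-1)%N ->
     l2norm (restrict_Delta (star_contr f f r r)) < 1) ->
  std_gaussian N ->
  kolmogorov_dist F N
    <= C1%:E *
       maxe `|1 - q`!%:R%:E * l2norm f ^+ 2|
         (maxe
           (\big[maxe/-oo]_(1 <= r < q)
              l2norm (restrict_Delta (star_contr f f r r)))
           (\big[maxe/-oo]_(1 <= r < q.+1)
              l2norm (star_contr f f r r.-1)))
  /\
  C1%:E *
       maxe `|1 - q`!%:R%:E * l2norm f ^+ 2|
         (maxe
           (\big[maxe/-oo]_(1 <= r < q)
              l2norm (restrict_Delta (star_contr f f r r)))
           (\big[maxe/-oo]_(1 <= r < q.+1)
              l2norm (star_contr f f r r.-1)))
    <= C2%:E *
       maxe `|1 - q`!%:R%:E * l2norm f ^+ 2|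
         (\big[maxe/-oo]_(1 <= r < q)
            l2norm (star_contr f f r r)).
Proof.
(* The sum of the three coefficients in the limiting bound, once each quantity in it is replaced by
   the maximum m. *)
pose C : R := (2 + 2 ^+ q.+1 * (2 * q%:R * q`!%:R ^+ 2) +
   4 * 3 ^+ q * (1 + 4 * q%:R) * q`!%:R ^+ 2)%R.
have q0 : (0 < q)%N by exact: ltnW.
have C0 : (0 < C)%R.
  have n0 (k : nat) : (0 <= k%:R :> R)%R by exact: ler0n.
  have h1 : (0 <= 2 ^+ q.+1 * (2 * q%:R * q`!%:R ^+ 2) :> R)%R.
    by rewrite mulr_ge0 ?exprn_ge0 // mulr_ge0 ?sqr_ge0 // mulr_ge0.
  have h2 : (0 <= 4 * 3 ^+ q * (1 + 4 * q%:R) * q`!%:R ^+ 2 :> R)%R.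
    by rewrite mulr_ge0 ?sqr_ge0 // mulr_ge0 ?mulr_ge0 ?exprn_ge0 // addr_ge0 // mulr_ge0.
  rewrite /C; lra.
exists C, C; split=> //; split=> // d T P X f F d' T' P' N hX hf hF _ hN.
set a := `|_|; set b := \big[_/_]_(_ <= _ < q) _; set c := \big[_/_]_(_ <= _ < q.+1) _.
have b_ge r : (0 < r < q)%N -> l2norm (restrict_Delta (star_contr f f r r)) <= b.
  move=> rq; apply: (@le_bigmax_seq _ _ _ _ _ r) => //.
  by rewrite mem_index_iota.
have c_ge r : (0 < r < q.+1)%N -> l2norm (star_contr f f r r.-1) <= c.
  move=> rq.
  apply: (@le_bigmax_seq _ _ _ _ _ r xpredT (fun r => l2norm (star_contr f f r r.-1))) => //.
  by rewrite mem_index_iota.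
split.
  have a0 : 0 <= a by exact: abse_ge0.
  (* An infinite maximum makes the bound trivial; -oo, the start value of the iterated maxima, is
     excluded by 0 <= a. *)
  case EM : (maxe a (maxe b c)) => [m| |]; last 2 first.
  - by rewrite gt0_muley ?leey // lte_fin.
  - by have := le_trans a0 (_ : a <= maxe a (maxe b c)); rewrite le_max lexx EM => /(_ isT).
  have am : a <= m%:E by rewrite -EM le_max lexx.
  have bm : b <= m%:E by rewrite -EM !le_max lexx orbT.
  have cm : c <= m%:E by rewrite -EM !le_max lexx !orbT.
  have m0 : (0 <= m)%R by rewrite -lee_fin (le_trans a0).
  have am' : (`|1 - q`!%:R * nrm2 f| <= m)%R.
    by move: am; rewrite /a -nrm2_EFin // -EFinM -EFinB lee_fin.
  rewrite -EFinM; apply: ge_ereal_sup => _ [x _ <-].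
  rewrite -!rcdf_EFin -EFinB lee_fin.
  apply: (cdf_distance_le hX hf hF hN q0 m0) => // [r rq|].
    exact: le_trans (b_ge _ rq) bm.
  by apply: le_trans cm; apply: c_ge; rewrite q0 ltnS leqnn.
(* With equal constants only the two maxima remain to be compared. *)
rewrite lee_pmul2l ?lte_fin //.
set b' := \big[_/_]_(_ <= _ < _) l2norm (star_contr f f _ _).
have b'_ge r : (0 < r < q)%N -> l2norm (star_contr f f r r) <= b'.
  move=> rq.
  apply: (@le_bigmax_seq _ _ _ _ _ r xpredT (fun r => l2norm (star_contr f f r r))) => //.
  by rewrite mem_index_iota.
rewrite ge_max le_max lexx /= ge_max !le_max; apply/andP; split; apply/orP; right.
  rewrite /b big_nat; apply: bigmax_le => [|r rq]; first exact: leNye.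
  exact: le_trans (l2norm_restrict_Delta _) (b'_ge _ rq).
have big2 r : (1 < r <= q)%N -> l2norm (star_contr f f r r.-1) <= b'.
  move=> rq; apply: le_trans (l2norm_star_pred_le f rq) _; apply: b'_ge; lia.
rewrite /c big_nat; apply: bigmax_le => [|r /andP[r0 rq]]; first exact: leNye.
have [r1|r1] := leqP r 1; last by apply: big2; rewrite r1 -ltnS.
have -> : r = 1%N by apply/eqP; rewrite eqn_leq r1.
(* The case r = 1 is reduced to r = q, which [big2] covers because q >= 2. *)
apply: le_trans (l2norm_star_1_0_le hf q0) _; apply: big2; lia.
Qed.
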